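(* Let $\mathbf{C}$ be a possibly non-unital $C^{*}$-category and let $\mathbf{M}\mathbf{C}$ be its multiplier category as defined in the context. Then: (1) $\mathbf{M}\mathbf{C}$, with the norm $\|(L,R)\|:=\max\{\|L\|,\|R\|\}$, is a unital $C^{*}$-category (and in fact $\|L\|=\|R\|$); (2) the functor $\mathbf{C}\to\mathbf{M}\mathbf{C}$, identity on objects and $f\mapsto (f\circ -,\,-\circ f)$ on morphisms, is the inclusion of an ideal; (3) for every unital $C^{*}$-category $\mathbf{D}$ and every ideal inclusion $\mathbf{C}\to\mathbf{D}$ there exists a unique unital $*$-functor $\mathbf{D}\to\mathbf{M}\mathbf{C}$ whose composition with $\mathbf{C}\to\mathbf{D}$ is the functor $\mathbf{C}\to\mathbf{M}\mathbf{C}$.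
   Context: A possibly non-unital $C^*$-category is a $C^*$-category in which identity morphisms need not exist. For objects $C,D$ of $\mathbf{C}$, a multiplier morphism $C\to D$ is a pair $(L,R)$ where $L=(L_E)_{E}$ is a family of linear maps $L_E\colon \mathrm{Hom}(E,C)\to\mathrm{Hom}(E,D)$ with $L_F(hg)=L_E(h)g$ for all $h\colon E\to C$, $g\colon F\to E$ and $\|L\|:=\sup_E\|L_E\|<\infty$; $R=(R_E)_E$ is a family of linear maps $R_E\colon\mathrm{Hom}(D,E)\to\mathrm{Hom}(C,E)$ with $R_F(gh)=gR_E(h)$ for all $h\colon D\to E$, $g\colon E\to F$ and $\|R\|:=\sup_E\|R_E\|<\infty$; and $gL_F(f)=R_E(g)f$ for all $f\colon F\to C$, $g\colon D\to E$. The multiplier category $\mathbf{M}\mathbf{C}$ has the objects of $\mathbf{C}$, multiplier morphisms as morphisms, composition $(L',R')\circ(L,R):=(L'L,RR')$, and involution $(L,R)^*:=(R^*,L^* )$ with $L^*_E(f):=R_E(f^* )^*$ and $R^*_E(f):=L_E(f^* )^*$. A $*$-functor $i\colon\mathbf{C}\to\mathbf{D}$ between possibly non-unital $C^*$-categories is an ideal inclusion if it is bijective on objects, an isometric embedding with closed image on morphism spaces, and the composition of any morphism in the image of $i$ with any morphism of $\mathbf{D}$ lies in the image of $i$. *)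

(* Defs.v *)
From mathcomp Require Import all_boot all_algebra.
From mathcomp Require Import boolp classical_sets reals.
From mathcomp Require Import complex.
Import GRing.Theory Num.Theory.
Set Implicit Arguments.
Unset Strict Implicit.
Unset Printing Implicit Defensive.
Local Open Scope ring_scope.
Local Open Scope classical_set_scope.

Record precat (R : realType) := Precat {
  obj : Type;
  chom : obj -> obj -> Type;
  hzero : forall x y, chom x y;
  hadd : forall x y, chom x y -> chom x y -> chom x y;
  hscale : forall x y, R[i] -> chom x y -> chom x y;
  hnorm : forall x y, chom x y -> R;
  hcomp : forall x y z, chom y z -> chom x y -> chom x z;
  hstar : forall x y, chom x y -> chom y x }.

Arguments obj {R}.
Arguments chom {R}.
Arguments hzero {R P x y} : rename.
Arguments hadd {R P x y} : rename.
Arguments hscale {R P x y} : rename.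
Arguments hnorm {R P x y} : rename.
Arguments hcomp {R P x y z} : rename.
Arguments hstar {R P x y} : rename.

Section CStar.
Variables (R : realType) (P : precat R).

Definition hsub (x y : obj P) (f g : chom P x y) : chom P x y :=
  hadd f (hscale (-1) g).

(* A "membership" predicate selecting the morphisms of the category among
   the raw data (all raw data for an honest C*-category, see cstar_cat). *)
Local Unset Implicit Arguments.
Definition homs_pred : Type := forall x y : obj P, chom P x y -> Prop.
Local Set Implicit Arguments.
Definition all_homs : homs_pred := fun _ _ _ => True.

Record is_cstar_on (M : homs_pred) : Prop := {
  cl_zero : forall x y, M x y hzero;
  cl_add : forall x y (f g : chom P x y), M _ _ f -> M _ _ g -> M _ _ (hadd f g);
  cl_scale : forall x y a (f : chom P x y), M _ _ f -> M _ _ (hscale a f);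
  cl_comp : forall x y z (g : chom P y z) (f : chom P x y),
      M _ _ g -> M _ _ f -> M _ _ (hcomp g f);
  cl_star : forall x y (f : chom P x y), M _ _ f -> M _ _ (hstar f);
  addA : forall x y (f g h : chom P x y), M _ _ f -> M _ _ g -> M _ _ h ->
      hadd f (hadd g h) = hadd (hadd f g) h;
  addC : forall x y (f g : chom P x y), M _ _ f -> M _ _ g -> hadd f g = hadd g f;
  add0 : forall x y (f : chom P x y), M _ _ f -> hadd f hzero = f;
  addN : forall x y (f : chom P x y), M _ _ f -> hadd f (hscale (-1) f) = hzero;
  scale1 : forall x y (f : chom P x y), M _ _ f -> hscale 1 f = f;
  scaleA : forall x y a b (f : chom P x y), M _ _ f ->
      hscale a (hscale b f) = hscale (a * b) f;
  scaleDr : forall x y a (f g : chom P x y), M _ _ f -> M _ _ g ->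
      hscale a (hadd f g) = hadd (hscale a f) (hscale a g);
  scaleDl : forall x y a b (f : chom P x y), M _ _ f ->
      hscale (a + b) f = hadd (hscale a f) (hscale b f);
  norm_ge0 : forall x y (f : chom P x y), M _ _ f -> 0 <= hnorm f;
  norm_eq0 : forall x y (f : chom P x y), M _ _ f -> hnorm f = 0 -> f = hzero;
  normZ : forall x y a (f : chom P x y), M _ _ f ->
      hnorm (hscale a f) = Normc.normc a * hnorm f;
  normD : forall x y (f g : chom P x y), M _ _ f -> M _ _ g ->
      hnorm (hadd f g) <= hnorm f + hnorm g;
  complete : forall x y (u : nat -> chom P x y), (forall n, M _ _ (u n)) ->
      (forall e : R, 0 < e -> exists N, forall m n, (N <= m)%N -> (N <= n)%N ->
          hnorm (hsub (u m) (u n)) < e) ->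
      exists l : chom P x y, M _ _ l /\
        (forall e : R, 0 < e -> exists N, forall n, (N <= n)%N ->
          hnorm (hsub (u n) l) < e);
  compDl : forall x y z (g1 g2 : chom P y z) (f : chom P x y),
      M _ _ g1 -> M _ _ g2 -> M _ _ f ->
      hcomp (hadd g1 g2) f = hadd (hcomp g1 f) (hcomp g2 f);
  compDr : forall x y z (g : chom P y z) (f1 f2 : chom P x y),
      M _ _ g -> M _ _ f1 -> M _ _ f2 ->
      hcomp g (hadd f1 f2) = hadd (hcomp g f1) (hcomp g f2);
  compZl : forall x y z a (g : chom P y z) (f : chom P x y), M _ _ g -> M _ _ f ->
      hcomp (hscale a g) f = hscale a (hcomp g f);
  compZr : forall x y z a (g : chom P y z) (f : chom P x y), M _ _ g -> M _ _ f ->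
      hcomp g (hscale a f) = hscale a (hcomp g f);
  compA : forall w x y z (h : chom P y z) (g : chom P x y) (f : chom P w x),
      M _ _ h -> M _ _ g -> M _ _ f ->
      hcomp h (hcomp g f) = hcomp (hcomp h g) f;
  norm_comp : forall x y z (g : chom P y z) (f : chom P x y), M _ _ g -> M _ _ f ->
      hnorm (hcomp g f) <= hnorm g * hnorm f;
  starD : forall x y (f g : chom P x y), M _ _ f -> M _ _ g ->
      hstar (hadd f g) = hadd (hstar f) (hstar g);
  starZ : forall x y a (f : chom P x y), M _ _ f ->
      hstar (hscale a f) = hscale (conjc a) (hstar f);
  starK : forall x y (f : chom P x y), M _ _ f -> hstar (hstar f) = f;
  star_comp : forall x y z (g : chom P y z) (f : chom P x y), M _ _ g -> M _ _ f ->
      hstar (hcomp g f) = hcomp (hstar f) (hstar g);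
  cstar_identity : forall x y (f : chom P x y), M _ _ f ->
      hnorm (hcomp (hstar f) f) = hnorm f ^+ 2;
  (* positivity: f^* f is a positive element of the C*-algebra End(x),
     i.e. of the form g^* g with g in End(x) *)
  star_pos : forall x y (f : chom P x y), M _ _ f ->
      exists g : chom P x x, M _ _ g /\ hcomp (hstar f) f = hcomp (hstar g) g }.

Definition cstar_cat : Prop := is_cstar_on all_homs.

Definition is_identity (M : homs_pred) (x : obj P) (e : chom P x x) : Prop :=
  [/\ M _ _ e,
      (forall y (f : chom P x y), M _ _ f -> hcomp f e = f) &
      (forall y (g : chom P y x), M _ _ g -> hcomp e g = g)].

Definition unital_on (M : homs_pred) : Prop :=
  forall x : obj P, exists e : chom P x x, is_identity M e.

Definition htransport (a b a' b' : obj P) (ea : a = a') (eb : b = b')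
    (g : chom P a b) : chom P a' b' :=
  eq_rect b (fun b'' => chom P a' b'')
    (eq_rect a (fun a'' => chom P a'' b) g a' ea) b' eb.

End CStar.

Arguments homs_pred {R}.
Arguments is_cstar_on {R} P M.
Arguments cstar_cat {R} P.
Arguments unital_on {R} P M.
Arguments is_identity {R P} M {x}.
Arguments all_homs {R P}.
Arguments hsub {R P x y}.
Arguments htransport {R P a b a' b'}.

Section Functors.
Local Unset Implicit Arguments.
Variables (R : realType) (P Q : precat R)
  (M : homs_pred P) (N : homs_pred Q)
  (F0 : obj P -> obj Q) (F1 : forall x y, chom P x y -> chom Q (F0 x) (F0 y)).

Definition is_star_functor : Prop :=
  [/\ (forall x y (f : chom P x y), M _ _ f -> N _ _ (F1 _ _ f)),
      (forall x y (f g : chom P x y), M _ _ f -> M _ _ g ->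
          F1 _ _ (hadd f g) = hadd (F1 _ _ f) (F1 _ _ g)),
      (forall x y a (f : chom P x y), M _ _ f -> F1 _ _ (hscale a f) = hscale a (F1 _ _ f)),
      (forall x y z (g : chom P y z) (f : chom P x y), M _ _ g -> M _ _ f ->
          F1 _ _ (hcomp g f) = hcomp (F1 _ _ g) (F1 _ _ f)) &
      (forall x y (f : chom P x y), M _ _ f -> F1 _ _ (hstar f) = hstar (F1 _ _ f))].

Definition is_unital_functor : Prop :=
  forall x (e : chom P x x), is_identity M e -> is_identity N (F1 _ _ e).

(* ideal inclusion: bijective on objects, isometric with closed image on
   morphism spaces, and the image is closed under composition on both
   sides with arbitrary morphisms of the target.  (Since F0 is bijective,
   every object of the target is of the form F0 z.) *)
Definition is_ideal_inclusion : Prop :=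
  is_star_functor /\
      bijective F0 /\
      (forall x y (f : chom P x y), M _ _ f -> hnorm (F1 _ _ f) = hnorm f) /\
      (forall x y (g : chom Q (F0 x) (F0 y)), N _ _ g ->
          (forall e : R, 0 < e -> exists f : chom P x y, M _ _ f /\
              hnorm (hsub g (F1 _ _ f)) < e) ->
          exists f : chom P x y, M _ _ f /\ g = F1 _ _ f) /\
      (forall x y z (f : chom P x y) (h : chom Q (F0 y) (F0 z)), M _ _ f -> N _ _ h ->
          exists g : chom P x z, M _ _ g /\ hcomp h (F1 _ _ f) = F1 _ _ g) /\
      (forall w x y (f : chom P x y) (h : chom Q (F0 w) (F0 x)), M _ _ f -> N _ _ h ->
          exists g : chom P w y, M _ _ g /\ hcomp (F1 _ _ f) h = F1 _ _ g).

End Functors.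

Arguments is_star_functor {R P Q} M N {F0} F1.
Arguments is_unital_functor {R P Q} M N {F0} F1.
Arguments is_ideal_inclusion {R P Q} M N {F0} F1.

Section Multiplier.
Local Unset Implicit Arguments.
Variables (R : realType) (P : precat R).

Definition mhom (c d : obj P) : Type :=
  ((forall E : obj P, chom P E c -> chom P E d) *
   (forall E : obj P, chom P d E -> chom P c E))%type.

Definition op_norm (A B : Type) (nA : A -> R) (nB : B -> R) (T : A -> B) : R :=
  sup [set r | exists h : A, nA h <= 1 /\ r = nB (T h)].

Definition fam_normL (c d : obj P) (L : forall E, chom P E c -> chom P E d) : R :=
  sup [set r | exists E : obj P, r = op_norm _ _ (@hnorm _ P E c) (@hnorm _ P E d) (L E)].
Definition fam_normR (c d : obj P) (Rf : forall E, chom P d E -> chom P c E) : R :=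
  sup [set r | exists E : obj P, r = op_norm _ _ (@hnorm _ P d E) (@hnorm _ P c E) (Rf E)].

Definition is_mult (c d : obj P) (m : mhom c d) : Prop :=
  let L := m.1 in let Rf := m.2 in
      (forall E (h h' : chom P E c), L E (hadd h h') = hadd (L E h) (L E h')) /\
      (forall E a (h : chom P E c), L E (hscale a h) = hscale a (L E h)) /\
      (forall E (h h' : chom P d E), Rf E (hadd h h') = hadd (Rf E h) (Rf E h')) /\
      (forall E a (h : chom P d E), Rf E (hscale a h) = hscale a (Rf E h)) /\
      (forall E F (h : chom P E c) (g : chom P F E), L F (hcomp h g) = hcomp (L E h) g) /\
      (forall E F (h : chom P d E) (g : chom P E F), Rf F (hcomp g h) = hcomp g (Rf E h)) /\
      (exists K : R, forall E (h : chom P E c), hnorm (L E h) <= K * hnorm h) /\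
      (exists K : R, forall E (h : chom P d E), hnorm (Rf E h) <= K * hnorm h) /\
      (forall E F (f : chom P F c) (g : chom P d E), hcomp g (L F f) = hcomp (Rf E g) f).

Definition mzero (c d : obj P) : mhom c d :=
  (fun E _ => hzero, fun E _ => hzero).
Definition madd (c d : obj P) (m m' : mhom c d) : mhom c d :=
  (fun E h => hadd (m.1 E h) (m'.1 E h), fun E h => hadd (m.2 E h) (m'.2 E h)).
Definition mscale (c d : obj P) (a : R[i]) (m : mhom c d) : mhom c d :=
  (fun E h => hscale a (m.1 E h), fun E h => hscale a (m.2 E h)).
Definition mnorm (c d : obj P) (m : mhom c d) : R :=
  Num.max (fam_normL c d m.1) (fam_normR c d m.2).
Definition mcomp (c d e : obj P) (m' : mhom d e) (m : mhom c d) : mhom c e :=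
  (fun E h => m'.1 E (m.1 E h), fun E h => m.2 E (m'.2 E h)).
Definition mstar (c d : obj P) (m : mhom c d) : mhom d c :=
  (fun E f => hstar (m.2 E (hstar f)), fun E g => hstar (m.1 E (hstar g))).

Definition MC : precat R :=
  @Precat R (obj P) mhom mzero madd mscale mnorm mcomp mstar.

Definition incl (c d : obj P) (f : chom P c d) : chom MC c d :=
  ((fun E h => hcomp f h), (fun E k => hcomp k f)) : mhom c d.

End Multiplier.

Arguments is_mult {R P c d}.
Arguments incl {R P c d}.
Arguments fam_normL {R P c d}.
Arguments fam_normR {R P c d}.
Arguments mhom {R} P.
Arguments MC {R} P.

(* Main.v *)
(* Nondegeneracy ([f f^* = 0] forces [f = 0]) makes a multiplier [(L, R)]
   determined by [L] and turns the relation [g L(f) = R(g) f] into linearity,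
   the module conditions and [||L|| = ||R||]; completeness and the C*-identity
   follow pointwise.  The substantial axiom is that [m^* m] has the form
   [g^* g] with [g] an endomorphism.

   In a unital C*-algebra call [a] positive if [a = s^2] with [s] self-adjoint.
   Iterating [w <- (y + w^2) / 2] gives [sqrt (1 - y)] for [||y|| <= 1], whence
   [a] is positive iff [|| r - a || <= r] for some [r >= 0]; thus positive
   elements are closed under addition, and no spectral theory is needed.  For
   [a = m^* m] and [p = |a| - a] one has [p a p = - q^2] with
   [q = |a|^(1/2) p], so that [t = m p] satisfies [t^* t + q^2 = 0].  For
   every [h] in the original category, [(t h)^* (t h) + (q h)^* (q h) = 0] is a
   sum of two elements [g^* g], [k^* k] with [g], [k] endomorphisms, so
   [t = 0]; this forces [a = |a|].

   An ideal inclusion [F] yields the multiplier [h |-> F^-1 (q F(h))] for each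
   [q], and any other extension agrees with it on products with [C]. *)
Require Import Defs.
From HB Require Import structures.
From mathcomp Require Import all_boot all_order all_algebra.
From mathcomp Require Import boolp classical_sets reals.
From mathcomp Require Import complex.
From mathcomp Require Import lra ring.
Import Order.TTheory GRing.Theory Num.Theory.
Set Implicit Arguments.
Unset Strict Implicit.
Unset Printing Implicit Defensive.
Local Open Scope ring_scope.

(** * Unital C*-algebras *)

(** Positivity of [x^* x] is not among the axioms; it is derived as [positive_starM]. *)
HB.mixin Record isCStarAlgebra (R : realType) A
    of GRing.Algebra R[i] A := {
  cnorm : A -> R;
  cstar : A -> A;
  cnorm_ge0 : forall x, 0 <= cnorm x;
  cnorm_eq0 : forall x, cnorm x = 0 -> x = 0;
  cnormZ : forall (k : R[i]) x, cnorm (k *: x) = Normc.normc k * cnorm x;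
  cnormD : forall x y, cnorm (x + y) <= cnorm x + cnorm y;
  cnormM : forall x y, cnorm (x * y) <= cnorm x * cnorm y;
  cstarD : forall x y, cstar (x + y) = cstar x + cstar y;
  cstarZ : forall (k : R[i]) x, cstar (k *: x) = conjc k *: cstar x;
  cstarK : involutive cstar;
  cstarM : forall x y, cstar (x * y) = cstar y * cstar x;
  cnorm_starM : forall x, cnorm (cstar x * x) = cnorm x ^+ 2;
  cauchy_cvg : forall u : nat -> A,
    (forall e : R, 0 < e -> exists N, forall m n, (N <= m)%N -> (N <= n)%N ->
       cnorm (u m - u n) < e) ->
    exists l, forall e : R, 0 < e -> exists N, forall n, (N <= n)%N ->
       cnorm (u n - l) < e }.

#[short(type="cstarAlgType")]
HB.structure Definition CStarAlgebra (R : realType) :=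
  {A of GRing.Algebra R[i] A & isCStarAlgebra R A}.

Local Notation "r %:C" := (real_complex _ r) : ring_scope.
Local Notation "x ^*" := (cstar x) : ring_scope.

Lemma normc_real (R : realType) (r : R) : 0 <= r -> Normc.normc r%:C = r.
Proof. by move=> r0; rewrite /= expr0n/= addr0 sqrtr_sqr ger0_norm. Qed.

Section CStarAlgebraTheory.
Variables (R : realType) (A : cstarAlgType R).
Implicit Types (a b x y z s t : A) (k : R[i]) (r : R).

Lemma cscalerM k k' x y : (k *: x) * (k' *: y) = (k * k') *: (x * y).
Proof. by rewrite -scalerAl -scalerAr scalerA. Qed.

Lemma cnorm0 : cnorm (0 : A) = 0.
Proof. by rewrite -(scale0r (0 : A)) cnormZ Normc.normc0 mul0r. Qed.

Lemma cnormN x : cnorm (- x) = cnorm x.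
Proof. by rewrite -scaleN1r cnormZ /= oppr0 expr0n sqrrN expr1n addr0 sqrtr1 mul1r. Qed.

Lemma cnormB x y : cnorm (x - y) <= cnorm x + cnorm y.
Proof. by rewrite -(cnormN y) cnormD. Qed.

Lemma cdistC x y : cnorm (x - y) = cnorm (y - x).
Proof. by rewrite -cnormN opprB. Qed.

Lemma cnormZr r x : 0 <= r -> cnorm (r%:C *: x) = r * cnorm x.
Proof. by move=> r0; rewrite cnormZ normc_real. Qed.

Lemma cstar0 : (0 : A)^* = 0.
Proof. by apply: (addIr (0 : A)^*); rewrite -cstarD !add0r. Qed.

Lemma cstar1 : (1 : A)^* = 1.
Proof. by rewrite -[RHS]cstarK -[in RHS](mulr1 1^*) cstarM cstarK mulr1. Qed.

Lemma cnorm1 : cnorm (1 : A) = 1.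
Proof.
have := cnorm_starM (1 : A); rewrite cstar1 mulr1 => /eqP.
rewrite expr2 -{1}(mulr1 (cnorm 1)) -subr_eq0 -mulrBr mulf_eq0 subr_eq0.
case/orP => /eqP // /cnorm_eq0 /eqP; by rewrite oner_eq0.
Qed.

Lemma cstarN x : (- x)^* = - x^*.
Proof. by apply: (addIr x^*); rewrite -cstarD !addNr cstar0. Qed.

Lemma cstarB x y : (x - y)^* = x^* - y^*.
Proof. by rewrite cstarD cstarN. Qed.

Lemma cstarZr r x : (r%:C *: x)^* = r%:C *: x^*.
Proof. by rewrite cstarZ conjc_real. Qed.

(** [||y||^2 = ||y^* y|| <= ||y^*|| ||y||], used for [y = x] and [y = x^*]. *)
Lemma cnorm_star x : cnorm x^* = cnorm x.
Proof.
have le y : cnorm y <= cnorm y^*.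
  have := cnorm_starM y; have := cnormM y^* y; rewrite expr2 => h1 h2.
  have := cnorm_ge0 y; have := cnorm_ge0 y^*; nra.
by apply/eqP; rewrite eq_le -{2}(cstarK x) !le.
Qed.

Lemma cnorm_sqr_sa x : x^* = x -> cnorm (x * x) = cnorm x ^+ 2.
Proof. by move=> {1}<-; rewrite cnorm_starM. Qed.

Definition converges (u : nat -> A) l :=
  forall e : R, 0 < e -> exists N, forall n, (N <= n)%N -> cnorm (u n - l) < e.

Lemma converges_unique u l l' : converges u l -> converges u l' -> l = l'.
Proof.
move=> ul ul'; apply/eqP; rewrite -subr_eq0; apply/eqP/cnorm_eq0/eqP.
rewrite eq_le cnorm_ge0 andbT; apply/ler_addgt0Pr => e e0; rewrite add0r.
have e20 : 0 < e / 2 by rewrite divr_gt0.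
have [N hN] := ul _ e20; have [N' hN'] := ul' _ e20.
have := hN _ (leq_maxl N N'); have := hN' _ (leq_maxr N N').
set n := maxn N N'; rewrite (cdistC _ l) => h1 h2.
have := cnormD (l - u n) (u n - l'); rewrite addrA subrK; lra.
Qed.

Lemma converges_shift u l : converges u l -> converges (fun n => u n.+1) l.
Proof. by move=> ul e /ul[N hN]; exists N => n /leqW; exact: hN. Qed.

Lemma converges_cst l : converges (fun=> l) l.
Proof. by move=> e e0; exists 0%N => n _; rewrite subrr cnorm0. Qed.

Lemma converges_star u l : converges u l -> converges (fun n => (u n)^*) l^*.
Proof.
move=> ul e /ul[N hN]; exists N => n /hN.
by rewrite -cstarB cnorm_star.
Qed.

Lemma convergesD u v l m :
  converges u l -> converges v m -> converges (fun n => u n + v n) (l + m).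
Proof.
move=> ul vm e e0; have e20 : 0 < e / 2 by rewrite divr_gt0.
have [N hN] := ul _ e20; have [N' hN'] := vm _ e20.
exists (maxn N N') => n; rewrite geq_max => /andP[/hN h1 /hN' h2].
by rewrite opprD addrACA; apply: (le_lt_trans (cnormD _ _)); lra.
Qed.

Lemma converges_mull u l z : converges u l -> converges (fun n => z * u n) (z * l).
Proof.
move=> ul e e0; have z0 := cnorm_ge0 z.
(* Adding [1] to [cnorm z] keeps the divisor positive when [z = 0]. *)
have [|N hN] := ul (e / (cnorm z + 1)); first by rewrite divr_gt0 // ltr_wpDl.
exists N => n /hN; rewrite ltr_pdivlMr ?ltr_wpDl // -mulrBr => h.
have := cnormM z (u n - l); have := cnorm_ge0 (u n - l); nra.
Qed.

(** Obtained from left multiplication by passing to adjoints. *)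
Lemma converges_mulr u l z : converges u l -> converges (fun n => u n * z) (l * z).
Proof.
move=> /converges_star /(converges_mull z^*) /converges_star.
rewrite cstarM !cstarK => h e /h[N hN]; exists N => n /hN.
by rewrite cstarM !cstarK.
Qed.

Lemma convergesZ u l k : converges u l -> converges (fun n => k *: u n) (k *: l).
Proof.
move=> /(converges_mull (k *: 1)); rewrite -scalerAl mul1r => h e /h[N hN].
by exists N => n /hN; rewrite -scalerAl mul1r.
Qed.

Lemma converges_sqr u l : (forall n, cnorm (u n) <= 1) ->
  converges u l -> converges (fun n => u n * u n) (l * l).
Proof.
move=> u1 ul e e0; have l0 := cnorm_ge0 l.
have [|N hN] := ul (e / (cnorm l + 1)); first by rewrite divr_gt0 // ltr_wpDl.
exists N => n /hN; rewrite ltr_pdivlMr ?ltr_wpDl // => h.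
have -> : u n * u n - l * l = (u n - l) * u n + l * (u n - l).
  by rewrite mulrBl mulrBr addrA subrK.
have := cnormD ((u n - l) * u n) (l * (u n - l)).
have := cnormM (u n - l) (u n); have := cnormM l (u n - l).
have := u1 n; have := cnorm_ge0 (u n - l); nra.
Qed.

Lemma converges_le u l r : (forall n, cnorm (u n) <= r) -> converges u l -> cnorm l <= r.
Proof.
move=> ur ul; apply/ler_addgt0Pr => e /ul[N /(_ _ (leqnn N))] h.
have := cnormD (u N) (l - u N); rewrite addrC subrK cdistC.
have := ur N; lra.
Qed.

End CStarAlgebraTheory.

(** * Square roots by iteration *)

Section SquareRoot.
Variables (R : realType) (A : cstarAlgType R) (y : A).
Hypotheses (y_sa : y^* = y) (y_le1 : cnorm y <= 1).

Fixpoint sqrt_iter n : A :=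
  if n is n'.+1 then (2^-1 : R)%:C *: (y + sqrt_iter n' * sqrt_iter n') else 0.

(** The same iteration for the scalar [1]: a majorant that controls both the size and the increments
    of [sqrt_iter]. *)
Fixpoint sqrt_bound n : R :=
  if n is n'.+1 then 2^-1 * (1 + sqrt_bound n' * sqrt_bound n') else 0.

Let w := sqrt_iter.
Let W := sqrt_bound.

Lemma sqrt_bound_01 n : 0 <= W n <= 1.
Proof.
elim: n => [|n /andP[h0 h1]]; first by rewrite /W /= lexx ler01.
rewrite /W /= -/(W n); apply/andP; split; nra.
Qed.

(** An increment equals [(1 - W n)^2 / 2]. *)
Lemma sqrt_bound_mono m n : (m <= n)%N -> W m <= W n.
Proof.
move/subnK <-; elim: (n - m)%N => [|k IH] //; apply: (le_trans IH).
change (W (k + m) <= 2^-1 * (1 + W (k + m) * W (k + m))).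
set t := W _; have := sqr_ge0 (t - 1); rewrite expr2 => h; lra.
Qed.

(** A monotone bounded sequence comes close to its supremum. The one-sided estimate is enough, since
    [sqrt_iter_dist] subtracts the earlier term from the later one. *)
Lemma sqrt_bound_cauchy (e : R) : 0 < e ->
  exists N, forall m n, (N <= m)%N -> (N <= n)%N -> W m - W n < e.
Proof.
move=> e0; pose E := [set r | exists n, r = W n]%classic.
have hE : has_sup E.
  split; first by exists (W 0%N), 0%N.
  by exists 1 => _ [n ->]; have /andP[] := sqrt_bound_01 n.
have [_ [N ->] hN] := sup_adherent e0 hE.
exists N => m n _ Nn; have := sqrt_bound_mono Nn.
have : W m <= sup E by apply: sup_upper_bound => //; exists m.
lra.
Qed.

Lemma sqrt_iter_le n : cnorm (w n) <= W n.
Proof.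
elim: n => [|n IH]; first by rewrite cnorm0.
rewrite /w /W /= -/(w n) -/(W n) cnormZr ?invr_ge0 //.
rewrite ler_wpM2l ?invr_ge0 //; apply: le_trans (cnormD _ _) _.
apply: lerD => //; apply: le_trans (cnormM _ _) _.
by apply: ler_pM => //; exact: cnorm_ge0.
Qed.

Lemma sqrt_iter_le1 n : cnorm (w n) <= 1.
Proof. by apply: le_trans (sqrt_iter_le n) _; have /andP[] := sqrt_bound_01 n. Qed.

(** Each iterate is a polynomial in [y]. *)
Lemma sqrt_iter_comm z : z * y = y * z -> forall n, z * w n = w n * z.
Proof.
move=> zy; elim=> [|n IH]; first by rewrite mulr0 mul0r.
rewrite /w /= -/(w n) -scalerAl -scalerAr mulrDl mulrDr zy.
by rewrite mulrA IH -!mulrA IH.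
Qed.

Lemma sqrt_iter_sa n : (w n)^* = w n.
Proof.
by elim: n => [|n IH]; rewrite /w /= ?cstar0 // -/(w n) cstarZr cstarD cstarM IH y_sa.
Qed.

(** As the iterates commute, [w n.+2 - w n.+1] is a difference of squares, half of
    [(w n.+1 - w n) (w n.+1 + w n)]; the scalars [W] factor in the same way and dominate both
    factors. *)
Lemma sqrt_iter_succ n : cnorm (w n.+1 - w n) <= W n.+1 - W n.
Proof.
elim: n => [|n IH].
  rewrite /w /W /= !mulr0 !addr0 !subr0 cnormZr ?invr_ge0 //.
  by rewrite ler_wpM2l ?invr_ge0.
have -> : w n.+2 - w n.+1 = (2^-1 : R)%:C *: ((w n.+1 - w n) * (w n.+1 + w n)).
  have wS k : w k.+1 = (2^-1 : R)%:C *: (y + w k * w k) by [].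
  rewrite (wS n.+1) [X in _ - X]wS -scalerBr; congr (_ *: _).
  rewrite opprD addrACA subrr add0r mulrBl !mulrDr.
  have -> : w n * w n.+1 = w n.+1 * w n.
    apply: sqrt_iter_comm; apply/esym; exact: (sqrt_iter_comm (erefl (y * y))).
  by rewrite opprD addrA addrK.
have -> : W n.+2 - W n.+1 = 2^-1 * ((W n.+1 - W n) * (W n.+1 + W n)).
  have WS k : W k.+1 = 2^-1 * (1 + W k * W k) by [].
  by rewrite (WS n.+1) [X in _ - X]WS; field.
rewrite cnormZr ?invr_ge0 // ler_wpM2l ?invr_ge0 //.
apply: le_trans (cnormM _ _) _; apply: ler_pM => //; try exact: cnorm_ge0.
by apply: le_trans (cnormD _ _) _; apply: lerD; exact: sqrt_iter_le.
Qed.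

Lemma sqrt_iter_dist m n : (m <= n)%N -> cnorm (w n - w m) <= W n - W m.
Proof.
move/subnK <-; elim: (n - m)%N => [|k IH]; first by rewrite !subrr cnorm0.
rewrite addSn; have := sqrt_iter_succ (k + m).
have := cnormD (w (k + m).+1 - w (k + m)%N) (w (k + m)%N - w m).
rewrite addrA subrK; lra.
Qed.

Lemma sqrt_iter_cvg : exists l, converges w l.
Proof.
apply: cauchy_cvg => e /sqrt_bound_cauchy[N hN]; exists N => m n Nm Nn.
have [/sqrt_iter_dist h|/ltnW/sqrt_iter_dist h] := leqP n m.
  exact: le_lt_trans h (hN _ _ Nm Nn).
by rewrite cdistC; apply: le_lt_trans h (hN _ _ Nn Nm).
Qed.

(* The limit [l] of the iteration solves [l = (y + l^2) / 2], i.e. [(1 - l)^2 = 1 - y]. *)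
Lemma sqrt_one_sub : exists s : A,
  [/\ s^* = s, s * s = 1 - y, cnorm (1 - s) <= 1 &
      forall z, z * y = y * z -> z * s = s * z].
Proof.
have [l wl] := sqrt_iter_cvg.
have l_sa : l^* = l.
  apply: converges_unique (converges_star wl) _ => e /wl[N hN].
  by exists N => n /hN; rewrite sqrt_iter_sa.
have l_eq : l = (2^-1 : R)%:C *: (y + l * l).
  apply: converges_unique (converges_shift wl) _; apply: convergesZ.
  apply: convergesD; first exact: converges_cst.
  apply: converges_sqr wl; exact: sqrt_iter_le1.
have l_comm z : z * y = y * z -> z * l = l * z.
  move=> zy; apply: converges_unique (converges_mull z wl) _ => e.
  move/(converges_mulr z wl)=> [N hN]; exists N => n /hN.
  by rewrite sqrt_iter_comm.
exists (1 - l); split.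
- by rewrite cstarB cstar1 l_sa.
- have yl : y + l * l = l + l.
    rewrite {3 4}l_eq -scalerDl -rmorphD /= -[LHS]scale1r; congr (_ *: _).
    by rewrite -(rmorph1 (real_complex R)) /=; congr _%:C; lra.
  have -> : y = l + l - l * l by rewrite -yl addrK.
  rewrite mulrBr mulr1 mulrBl mul1r !opprB opprD -addrA; congr (1 + _).
  by rewrite addrCA.
- by rewrite opprB addrC subrK; apply: converges_le wl; exact: sqrt_iter_le1.
- by move=> z /l_comm zl; rewrite mulrBr mulrBl mulr1 mul1r zl.
Qed.

End SquareRoot.

(** * Positive elements *)

Section Positivity.
Variables (R : realType) (A : cstarAlgType R).
Implicit Types (a b p q s t x y z : A) (r : R).

(** Asking for a self-adjoint root makes positivity testable by norms ([sqrt_sub_norm],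
    [positive_norm]); that every [t^* t] qualifies is the harder fact [positive_starM]. *)
Definition positive a := exists2 s, s^* = s & a = s * s.

Lemma positive_star a : positive a -> a^* = a.
Proof. by case=> s s_sa ->; rewrite cstarM s_sa. Qed.

(** For [r > 0] the element [y = 1 - a / r] has norm at most [1], so [1 - y = a / r] has a square
    root; for [r = 0] the bound forces [a = 0]. *)
Lemma sqrt_sub_norm a r : a^* = a -> 0 <= r -> cnorm (r%:C *: 1 - a) <= r ->
  exists s, [/\ s * s = a, positive s & forall z, z * a = a * z -> z * s = s * z].
Proof.
move=> a_sa; rewrite le_eqVlt => /predU1P[<-|r0] ra.
  have -> : a = 0.
    apply: cnorm_eq0; apply/eqP; rewrite eq_le cnorm_ge0 andbT.
    by move: ra; rewrite scale0r sub0r cnormN.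
  exists 0; split; rewrite ?mul0r //; exists 0; rewrite ?cstar0 ?mul0r //.
have rK : r%:C * (r^-1)%:C = 1 by rewrite -rmorphM /= divff ?gt_eqF ?rmorph1.
pose y := 1 - (r^-1)%:C *: a.
have y_sa : y^* = y by rewrite cstarB cstar1 cstarZr a_sa.
have y1 : cnorm y <= 1.
  have -> : y = (r^-1)%:C *: (r%:C *: 1 - a).
    by rewrite scalerBr scalerA mulrC rK scale1r.
  by rewrite cnormZr ?invr_ge0 ?(ltW r0) // ler_pdivrMl // mulr1.
have [s [s_sa s2 s1 scomm]] := sqrt_one_sub y_sa y1.
(* The bound [||1 - s|| <= 1] allows a second extraction, with [1 - s] in place of [y]: [u^2 = s]
   shows that the root is itself positive. *)
have [u [u_sa u2 _ _]] : exists u : A, [/\ u^* = u, u * u = 1 - (1 - s), cnorm (1 - u) <= 1 &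
      forall z, z * (1 - s) = (1 - s) * z -> z * u = u * z].
  by apply: sqrt_one_sub s1; rewrite cstarB cstar1 s_sa.
have sqK (c : R) : 0 <= c -> (Num.sqrt c)%:C * (Num.sqrt c)%:C = c%:C.
  by move=> c0; rewrite -rmorphM /= -expr2 sqr_sqrtr.
exists ((Num.sqrt r)%:C *: s); split.
- by rewrite cscalerM sqK ?(ltW r0) // s2 opprB addrC subrK scalerA rK scale1r.
- exists ((Num.sqrt (Num.sqrt r))%:C *: u); first by rewrite cstarZr u_sa.
  by rewrite cscalerM sqK ?sqrtr_ge0 // u2 opprB addrC subrK.
- move=> z za; rewrite -scalerAl -scalerAr scomm // mulrBl mulrBr mul1r mulr1.
  by rewrite -scalerAl -scalerAr za.
Qed.

(* [b + i sqrt(1 - b^2)] is unitary, so its imaginary part is a contraction. *)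
Lemma cnorm_one_sub_sqr b : b^* = b -> cnorm b <= 1 -> cnorm (1 - b * b) <= 1.
Proof.
move=> b_sa b1.
have bb_sa : (b * b)^* = b * b by rewrite cstarM b_sa.
have bb1 : cnorm (b * b) <= 1.
  by rewrite cnorm_sqr_sa // expr_le1 ?cnorm_ge0.
have [s [s_sa s2 _ scomm]] := sqrt_one_sub bb_sa bb1.
have bs : b * s = s * b by apply: scomm; rewrite mulrA.
rewrite -s2 cnorm_sqr_sa // expr_le1 ?cnorm_ge0 //.
pose i : R[i] := 'i%C; pose u := b + i *: s.
have conj_i : conjc i = - i by rewrite /i /=; congr Complex; rewrite oppr0.
have ii : i * i = -1 by rewrite -expr2 sqr_i.
have u_star : u^* = b - i *: s by rewrite cstarD cstarZ b_sa s_sa conj_i scaleNr.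
have u1 : cnorm u <= 1.
  have : cnorm u ^+ 2 = 1.
    rewrite -cnorm_starM u_star /u mulrDr !mulrBl -scalerAl -!scalerAr bs.
    rewrite -scalerAl addrA subrK scalerA ii scaleN1r opprK s2.
    by rewrite addrC subrK cnorm1.
  by have := cnorm_ge0 u; rewrite expr2; nra.
have -> : s = (2^-1 : R)%:C *: ((- i) *: (u - u^*)).
  rewrite u_star /u opprB [_ + (_ - b)]addrC addrA subrK -scalerDl !scalerA.
  rewrite (_ : _ * _ = 1) ?scale1r // -mulrA mulrDr !mulNr ii opprK.
  rewrite -(rmorph1 (real_complex R)) -rmorphD -rmorphM /=; congr _%:C; lra.
rewrite cnormZr ?invr_ge0 // cnormZ (_ : Normc.normc (- i) = 1); last first.
  by rewrite /= oppr0 expr0n sqrrN expr1n add0r sqrtr1.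
have := cnormB u u^*; rewrite cnorm_star; lra.
Qed.

(** Converse of [sqrt_sub_norm]: dividing [s] by the square root of [r] reduces to
    [cnorm_one_sub_sqr]. *)
Lemma positive_norm a r : positive a -> cnorm a <= r -> cnorm (r%:C *: 1 - a) <= r.
Proof.
case=> s s_sa ->; rewrite cnorm_sqr_sa // => sr.
have := le_trans (sqr_ge0 _) sr; rewrite le_eqVlt => /predU1P[r0|r0].
  have -> : s = 0.
    apply: cnorm_eq0; apply/eqP; rewrite -sqrf_eq0 eq_le sqr_ge0 andbT.
    by rewrite (le_trans sr) // -r0.
  by rewrite mul0r subr0 -r0 scale0r cnorm0.
pose c := Num.sqrt r; have c0 : 0 < c by rewrite sqrtr_gt0.
have cK : c * c^-1 = 1 by rewrite divff ?gt_eqF.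
have rE : r = c * c by rewrite -expr2 sqr_sqrtr ?(ltW r0).
pose b := (c^-1)%:C *: s.
have b_sa : b^* = b by rewrite cstarZr s_sa.
have b1 : cnorm b <= 1.
  rewrite cnormZr ?invr_ge0 ?(ltW c0) // ler_pdivrMl // mulr1.
  have := cnorm_ge0 s; move: sr; rewrite rE expr2; nra.
have -> : r%:C *: 1 - s * s = r%:C *: (1 - b * b).
  rewrite scalerBr cscalerM scalerA (_ : r%:C * _ = 1) ?scale1r //.
  by rewrite -!rmorphM /= [X in X * _]rE mulrACA cK mulr1 rmorph1.
by rewrite cnormZr ?(ltW r0) // ler_piMr ?(ltW r0) // cnorm_one_sub_sqr.
Qed.

(** The radius [||a||] is admissible by [positive_norm]. The root gained is better than the
    arbitrary one in [positive]: later arguments need its positivity and its commutation. *)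
Lemma positive_sqrt a : positive a ->
  exists s, [/\ s * s = a, positive s & forall z, z * a = a * z -> z * s = s * z].
Proof.
move=> a0; apply: (@sqrt_sub_norm _ (cnorm a)); rewrite ?cnorm_ge0 //.
  exact: positive_star.
exact: positive_norm.
Qed.

(** The norm criterion is additive by the triangle inequality, with radii [||a||] and [||b||]. *)
Lemma positiveD a b : positive a -> positive b -> positive (a + b).
Proof.
move=> a0 b0; pose r := cnorm a + cnorm b.
have [||| s [s2 /positive_star s_sa _]] := @sqrt_sub_norm (a + b) r.
- by rewrite cstarD !positive_star.
- by rewrite addr_ge0 ?cnorm_ge0.
- rewrite /r rmorphD scalerDl opprD addrACA; apply: le_trans (cnormD _ _) _.
  by apply: lerD; exact: positive_norm.
by exists s.
Qed.

Lemma sa_sqr_eq0 s : s^* = s -> s * s = 0 -> s = 0.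
Proof.
move=> s_sa /(congr1 (@cnorm _ _)); rewrite cnorm0 cnorm_sqr_sa // => /eqP.
by rewrite sqrf_eq0 => /eqP /cnorm_eq0.
Qed.

Lemma starM_eq0 s : s^* * s = 0 -> s = 0.
Proof.
move=> /(congr1 (@cnorm _ _)); rewrite cnorm0 cnorm_starM => /eqP.
by rewrite sqrf_eq0 => /eqP /cnorm_eq0.
Qed.

(* If [a = t^2 = - s^2] with [s], [t] commuting, then [s + i t] has square norm [0]. *)
Lemma positive_anti a : positive a -> positive (- a) -> a = 0.
Proof.
move=> /positive_sqrt[t [t2 /positive_star t_sa tcomm]] [s s_sa s2].
have st : s * t = t * s.
  apply: tcomm; have -> : a = - (s * s) by rewrite -s2 opprK.
  by rewrite mulrN mulNr mulrA.
pose i : R[i] := 'i%C.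
have conj_i : conjc i = - i by rewrite /i /=; congr Complex; rewrite oppr0.
have ii : i * i = -1 by rewrite -expr2 sqr_i.
pose u := s + i *: t.
have u_star : u^* = s - i *: t by rewrite cstarD cstarZ t_sa s_sa conj_i scaleNr.
have u0 : u = 0.
  apply: starM_eq0; rewrite u_star /u mulrDr !mulrBl -scalerAl -!scalerAr st.
  by rewrite -scalerAl addrA subrK scalerA ii scaleN1r opprK t2 -s2 addNr.
have s0 : s + s = u + u^* by rewrite u_star /u addrACA subrr addr0.
suff s_eq0 : s = 0 by rewrite -[a]opprK s2 s_eq0 mulr0 oppr0.
rewrite -[s]scale1r -(rmorph1 (real_complex R)) (_ : 1 = 2^-1 + 2^-1); last by lra.
by rewrite rmorphD scalerDl -scalerDr s0 u0 cstar0 addr0 scaler0.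
Qed.

Lemma positive_sqr s : s^* = s -> positive (s * s).
Proof. by exists s. Qed.

Lemma positiveD_eq0 a b : positive a -> positive b -> a + b = 0 -> a = 0.
Proof.
move=> a0 b0 /eqP; rewrite addrC addr_eq0 => /eqP ba.
by apply: positive_anti; rewrite // -ba.
Qed.

(* With [r = t q] one gets [r r^* = - (t t^* )^2] and [r^* r = - q^4], while
   [r^* r + r r^*] is a sum of squares of self-adjoint elements. *)
Lemma starM_eq_opp_sqr t q : q^* = q -> t^* * t = - (q * q) -> t = 0.
Proof.
move=> q_sa tq.
pose i : R[i] := 'i%C.
have conj_i : conjc i = - i by rewrite /i /=; congr Complex; rewrite oppr0.
have ii : i * i = -1 by rewrite -expr2 sqr_i.
pose r := t * q; pose z := t * t^*.
have z_sa : z^* = z by rewrite cstarM cstarK.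
have qq_sa : (q * q)^* = q * q by rewrite cstarM q_sa.
have rr1 : r * r^* = - (z * z).
  rewrite /r cstarM q_sa !mulrA -(mulrA t q q).
  by rewrite -[q * q]opprK -tq mulrN mulNr !mulrA.
have rr2 : r^* * r = - (q * q * (q * q)).
  by rewrite /r cstarM q_sa !mulrA -(mulrA q t^* t) tq mulrN mulNr !mulrA.
(* Up to sign, [x] and [y] are twice the real and imaginary parts of [r], so [x^2 + y^2 = 2 (r r^* +
   r^* r) = - 2 z^2 - 2 q^4]. *)
pose x := r + r^*; pose y := i *: (r - r^*).
have x_sa : x^* = x by rewrite cstarD cstarK addrC.
have y_sa : y^* = y by rewrite cstarZ conj_i cstarB cstarK scaleNr -scalerN opprB.
have xy : x * x + y * y = (r * r^* + r^* * r) + (r * r^* + r^* * r).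
  rewrite cscalerM ii scaleN1r /x mulrBl !mulrBr mulrDl !mulrDr !opprB.
  rewrite [X in _ + X]addrC addrACA.
  have twice (b c : A) : b + c + (c - b) = c + c by rewrite addrC addrA subrK.
  by rewrite twice [_ * r + _]addrC twice addrACA.
have pz := positive_sqr z_sa; have pq := positive_sqr qq_sa.
have sum0 : (q * q * (q * q)) + ((q * q * (q * q)) + (z * z + z * z + (x * x + y * y))) = 0.
  by rewrite xy rr1 rr2 -!opprD addrACA opprD (addrA (z * z + z * z)) subrr sub0r addrA subrr.
(* Summands of a vanishing sum of positive elements vanish; hence [q^4 = 0], then [q^2 = 0] and
   [t^* t = 0]. *)
have q4 := positiveD_eq0 pq (positiveD pq (positiveD (positiveD pz pz)
  (positiveD (positive_sqr x_sa) (positive_sqr y_sa)))) sum0.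
by apply: starM_eq0; rewrite tq (sa_sqr_eq0 qq_sa q4) oppr0.
Qed.

(* Applied with [p = |a| - a], for which [p a p = - |a| p^2]. *)
Lemma positive_criterion a : a^* = a ->
  (forall p q, p^* = p -> q^* = q -> p * a * p = - (q * q) -> p * a * p = 0) ->
  positive a.
Proof.
move=> a_sa crit.
(* [m] is the absolute value of [a] and [u] its square root; [a], [m], [u] and [p] all commute. *)
have [m [m2 m_pos mcomm]] := positive_sqrt (positive_sqr a_sa).
have m_sa := positive_star m_pos.
have [u [u2 /positive_star u_sa ucomm]] := positive_sqrt m_pos.
have am : a * m = m * a by apply: mcomm; rewrite mulrA.
pose p := m - a.
have p_sa : p^* = p by rewrite cstarB m_sa a_sa.
have pm : p * m = m * p by rewrite mulrBl mulrBr am.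
have ap : a * p = - (p * m) by rewrite mulrBr mulrBl -m2 opprB am.
have pa : p * a = - (p * m) by rewrite -ap mulrBl mulrBr am.
have pu : p * u = u * p by exact: ucomm.
pose q := u * p.
have q_sa : q^* = q by rewrite cstarM p_sa u_sa.
have qq : q * q = p * p * m.
  by rewrite /q -mulrA (mulrA p u) pu -!mulrA (mulrA u u) u2 pm [RHS]mulrA pm mulrA.
have pap : p * a * p = - (q * q) by rewrite pa mulNr qq -!mulrA pm.
have ppm : p * p * m = 0 by rewrite -qq -[q * q]opprK -pap (crit _ q) ?oppr0.
have ppa : p * p * a = 0 by rewrite -mulrA pa mulrN mulrA ppm oppr0.
(* [p^3 = p^2 m - p^2 a] has both terms zero. Then [p^4 = 0], and [sa_sqr_eq0] applied to [p^2] and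
   to [p] gives [p = 0]. *)
have p3 : p * p * p = 0 by rewrite {3}/p mulrBr ppm ppa subr0.
have p0 : p = 0.
  apply: sa_sqr_eq0 => //; apply: sa_sqr_eq0; first by rewrite cstarM p_sa.
  by rewrite mulrA p3 mul0r.
by have /eqP := p0; rewrite subr_eq0 => /eqP <-.
Qed.

(** [p (t^* t) p = (t p)^* (t p)], so [starM_eq_opp_sqr] supplies the hypothesis of the
    criterion. *)
Lemma positive_starM t : positive (t^* * t).
Proof.
apply: positive_criterion; first by rewrite cstarM cstarK.
move=> p q p_sa q_sa; have -> : p * (t^* * t) * p = (t * p)^* * (t * p).
  by rewrite cstarM p_sa !mulrA.
by move=> /(starM_eq_opp_sqr q_sa) ->; rewrite mulr0.
Qed.

Lemma starM_add_eq0 s t : s^* * s + t^* * t = 0 -> s = 0.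
Proof.
by move=> /(positiveD_eq0 (positive_starM _) (positive_starM _)) /starM_eq0.
Qed.

End Positivity.

(** * Morphism spaces and operator norms *)

Section OperatorNorm.
Variables (R : realType) (I : Type) (A B : I -> lmodType R[i]).
Variables (nA : forall i, A i -> R) (nB : forall i, B i -> R).
Variable T : forall i, A i -> B i.
Arguments nA {i}. Arguments nB {i}. Arguments T {i}.

(** A common form of [fam_normL] and [fam_normR], both of which are convertible to it. *)
Definition sup_op_norm : R :=
  sup [set r | exists i, r = op_norm _ _ _ (@nA i) (@nB i) (@T i)]%classic.

Hypothesis nA_ge0 : forall i (a : A i), 0 <= nA a.
Hypothesis nB_ge0 : forall i (b : B i), 0 <= nB b.
Hypothesis nAZ : forall i k (a : A i), nA (k *: a) = Normc.normc k * nA a.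
Hypothesis nBZ : forall i k (b : B i), nB (k *: b) = Normc.normc k * nB b.
Hypothesis TZ : forall i k (a : A i), T (k *: a) = k *: T a.

Lemma op_norm_le i K : 0 <= K -> (forall a : A i, nB (T a) <= K * nA a) ->
  op_norm _ _ _ (@nA i) (@nB i) (@T i) <= K.
Proof.
move=> K0 TK; apply: ge_sup.
  by exists (nB (T (0 : A i))), 0; split=> //; rewrite -(scale0r 0) nAZ Normc.normc0 mul0r.
move=> _ [a [a1 ->]]; apply: le_trans (TK a) _.
by rewrite -[leRHS]mulr1 ler_wpM2l.
Qed.

Lemma sup_op_norm_le K : inhabited I -> 0 <= K ->
  (forall i (a : A i), nB (T a) <= K * nA a) -> sup_op_norm <= K.
Proof.
move=> [i0] K0 TK; apply: ge_sup; first by eexists; exists i0.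
by move=> _ [i ->]; apply: op_norm_le.
Qed.

Hypothesis T_bounded : exists K, forall i (a : A i), nB (T a) <= K * nA a.

(** Boundedness makes both nested suprema genuine, since [sup] of an unbounded set is a default
    value. *)
Lemma sup_op_norm_ub i (a : A i) : nA a <= 1 -> nB (T a) <= sup_op_norm.
Proof.
(* The absolute value provides the nonnegative constant that [op_norm_le] asks for. *)
move=> a1; have [K0 TK0] := T_bounded; pose K := `|K0|.
have TK j (b : A j) : nB (T b) <= K * nA b.
  by apply: le_trans (TK0 _ _) _; rewrite ler_wpM2r // ler_norm.
apply: (@le_trans _ _ (op_norm _ _ _ (@nA i) (@nB i) (@T i))); apply: ub_le_sup.
- exists K => _ [b [b1 ->]]; apply: le_trans (TK _ _) _.
  by rewrite -[leRHS]mulr1 ler_wpM2l ?normr_ge0.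
- by exists a.
- by exists K => _ [j ->]; apply: op_norm_le; rewrite ?normr_ge0.
- by exists i.
Qed.

Lemma sup_op_norm_ge0 : inhabited I -> 0 <= sup_op_norm.
Proof.
move=> [j]; apply: le_trans (nB_ge0 (T (0 : A j))) (sup_op_norm_ub _).
by rewrite -(scale0r 0) nAZ Normc.normc0 mul0r.
Qed.

(** Rescale [a] to norm one. When [nA a = 0], boundedness already gives [nB (T a) <= 0]. *)
Lemma le_sup_op_norm i (a : A i) : nB (T a) <= sup_op_norm * nA a.
Proof.
have [a0|a_neq0] := eqVneq (nA a) 0.
  by have [K TK] := T_bounded; have := TK _ a; rewrite a0 !mulr0.
have a_gt0 : 0 < nA a by rewrite lt_neqAle eq_sym a_neq0 nA_ge0.
have ai : 0 <= (nA a)^-1 by rewrite invr_ge0.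
rewrite -ler_pdivrMr // mulrC -(normc_real ai) -nBZ -TZ sup_op_norm_ub //.
by rewrite nAZ normc_real // mulVf.
Qed.

End OperatorNorm.

(** * Morphism spaces of a C*-category as modules *)

Section CStarCategory.
Variables (R : realType) (P : precat R) (H : cstar_cat P).

(** A copy of [chom P x y] whose type mentions the proof [H]: the module laws come from [H], so the
    canonical instances must be able to find it in the type. *)
Definition homsp (_ : cstar_cat P) (x y : obj P) : Type := chom P x y.

Section HomModule.
Variables x y : obj P.
Notation V := (homsp H x y).

Let add0r : left_id (hzero : V) hadd.
Proof. by move=> f; rewrite (Defs.addC H I I) (Defs.add0 H I). Qed.
Let addNr : left_inverse (hzero : V) (hscale (-1)) hadd.
Proof. by move=> f; rewrite (Defs.addC H I I) (Defs.addN H I). Qed.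

HB.instance Definition _ := gen_eqMixin V.
HB.instance Definition _ := gen_choiceMixin V.
HB.instance Definition _ := GRing.isZmodule.Build V
  (fun f g h => Defs.addA H I I I) (fun f g => Defs.addC H I I) add0r addNr.
HB.instance Definition _ := GRing.Zmodule_isLmodule.Build R[i] V
  (fun a b f => Defs.scaleA H a b I) (fun f => Defs.scale1 H I)
  (fun a f g => Defs.scaleDr H a I I) (fun f a b => Defs.scaleDl H a b I).
End HomModule.

Implicit Types x y z w : obj P.

Lemma hnorm_ge0 x y (f : homsp H x y) : 0 <= hnorm f.
Proof. exact: (Defs.norm_ge0 H I). Qed.

Lemma hnorm_eq0 x y (f : homsp H x y) : hnorm f = 0 -> f = 0.
Proof. exact: (Defs.norm_eq0 H I). Qed.

Lemma hnormZ x y k (f : homsp H x y) : hnorm (k *: f) = Normc.normc k * hnorm f.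
Proof. exact: (Defs.normZ H _ I). Qed.

Lemma hnormD x y (f g : homsp H x y) : hnorm (f + g) <= hnorm f + hnorm g.
Proof. exact: (Defs.normD H I I). Qed.

Lemma hnorm0 x y : hnorm (0 : homsp H x y) = 0.
Proof. by rewrite -(scale0r (0 : homsp H x y)) hnormZ Normc.normc0 mul0r. Qed.

Lemma hnormN x y (f : homsp H x y) : hnorm (- f) = hnorm f.
Proof.
by rewrite -scaleN1r hnormZ /= oppr0 expr0n sqrrN expr1n addr0 sqrtr1 mul1r.
Qed.

Lemma hdistC x y (f g : homsp H x y) : hnorm (f - g) = hnorm (g - f).
Proof. by rewrite -hnormN opprB. Qed.

Lemma hdist_triangle x y (g f h : homsp H x y) :
  hnorm (f - h) <= hnorm (f - g) + hnorm (g - h).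
Proof. by have := hnormD (f - g) (g - h); rewrite addrA subrK. Qed.

Lemma hnorm_comp x y z (g : homsp H y z) (f : homsp H x y) :
  hnorm (hcomp g f) <= hnorm g * hnorm f.
Proof. exact: (Defs.norm_comp H I I). Qed.

Lemma hcompDl x y z (g g' : homsp H y z) (f : homsp H x y) :
  hcomp (g + g') f = (hcomp g f : homsp H x z) + hcomp g' f.
Proof. exact: (Defs.compDl H I I I). Qed.

Lemma hcompDr x y z (g : homsp H y z) (f f' : homsp H x y) :
  hcomp g (f + f') = (hcomp g f : homsp H x z) + hcomp g f'.
Proof. exact: (Defs.compDr H I I I). Qed.

Lemma hcompZl x y z k (g : homsp H y z) (f : homsp H x y) :
  hcomp (k *: g) f = k *: (hcomp g f : homsp H x z).
Proof. exact: (Defs.compZl H _ I I). Qed.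

Lemma hcompZr x y z k (g : homsp H y z) (f : homsp H x y) :
  hcomp g (k *: f) = k *: (hcomp g f : homsp H x z).
Proof. exact: (Defs.compZr H _ I I). Qed.

Lemma hcompA x y z w (h : homsp H z w) (g : homsp H y z) (f : homsp H x y) :
  hcomp h (hcomp g f) = hcomp (hcomp h g) f.
Proof. exact: (Defs.compA H I I I). Qed.

Lemma hcompBl x y z (g g' : homsp H y z) (f : homsp H x y) :
  hcomp (g - g') f = (hcomp g f : homsp H x z) - (hcomp g' f : homsp H x z).
Proof. by rewrite hcompDl -scaleN1r hcompZl scaleN1r. Qed.

Lemma hcompBr x y z (g : homsp H y z) (f f' : homsp H x y) :
  hcomp g (f - f') = (hcomp g f : homsp H x z) - (hcomp g f' : homsp H x z).
Proof. by rewrite hcompDr -scaleN1r hcompZr scaleN1r. Qed.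

Lemma hcomp0l x y z (f : homsp H x y) : hcomp (0 : homsp H y z) f = 0 :> homsp H x z.
Proof. by rewrite -(scale0r (0 : homsp H y z)) hcompZl scale0r. Qed.

Lemma hcomp0r x y z (g : homsp H y z) : hcomp g (0 : homsp H x y) = 0 :> homsp H x z.
Proof. by rewrite -(scale0r (0 : homsp H x y)) hcompZr scale0r. Qed.

Lemma hstarD x y (f g : homsp H x y) : hstar (f + g) = (hstar f : homsp H y x) + hstar g.
Proof. exact: (Defs.starD H I I). Qed.

Lemma hstarZ x y k (f : homsp H x y) : hstar (k *: f) = conjc k *: (hstar f : homsp H y x).
Proof. exact: (Defs.starZ H _ I). Qed.

Lemma hstar0 x y : hstar (0 : homsp H x y) = 0 :> homsp H y x.
Proof. by rewrite -(scale0r (0 : homsp H x y)) hstarZ conjc0 scale0r. Qed.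

Lemma hstarK x y (f : homsp H x y) : hstar (hstar f) = f.
Proof. exact: (Defs.starK H I). Qed.

Lemma hstar_comp x y z (g : homsp H y z) (f : homsp H x y) :
  hstar (hcomp g f) = hcomp (hstar f) (hstar g).
Proof. exact: (Defs.star_comp H I I). Qed.

Lemma hnorm_star_comp x y (f : homsp H x y) : hnorm (hcomp (hstar f) f) = hnorm f ^+ 2.
Proof. exact: (Defs.cstar_identity H I). Qed.

Lemma hnorm_star x y (f : homsp H x y) : hnorm (hstar f) = hnorm f.
Proof.
have le u v (g : homsp H u v) : hnorm g <= hnorm (hstar g).
  have := hnorm_star_comp g; have := hnorm_comp (hstar g) g; rewrite expr2 => h1 h2.
  have := hnorm_ge0 g; have := @hnorm_ge0 v u (hstar g); nra.
by apply/eqP; rewrite eq_le -{2}(hstarK f) !le.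
Qed.

Lemma hnorm_comp_star x y (f : homsp H x y) : hnorm (hcomp f (hstar f)) = hnorm f ^+ 2.
Proof. by rewrite -{1}(hstarK f) hnorm_star_comp hnorm_star. Qed.

(** Taking [h = hstar (f - f')], the C*-identity yields [||f - f'||^2 = 0]; this stands in for
    composing with an identity. *)
Lemma hcomp_faithful_r x y (f f' : homsp H x y) :
  (forall z (h : homsp H z x), hcomp f h = hcomp f' h) -> f = f'.
Proof.
move=> ff'; apply/eqP; rewrite -subr_eq0; apply/eqP/hnorm_eq0/eqP.
by rewrite -sqrf_eq0 -hnorm_comp_star hcompBl ff' subrr hnorm0.
Qed.

Lemma hcomp_faithful_l x y (f f' : homsp H x y) :
  (forall z (h : homsp H y z), hcomp h f = hcomp h f') -> f = f'.
Proof.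
move=> ff'; apply/eqP; rewrite -subr_eq0; apply/eqP/hnorm_eq0/eqP.
by rewrite -sqrf_eq0 -hnorm_star_comp hcompBr ff' subrr hnorm0.
Qed.

Lemma hdist_eq0 x y (f g : homsp H x y) (K : R) :
  (forall e, 0 < e -> hnorm (f - g) <= K * e) -> f = g.
Proof.
move=> fg; apply/eqP; rewrite -subr_eq0; apply/eqP/hnorm_eq0/eqP.
rewrite eq_le hnorm_ge0 andbT; apply/ler_addgt0Pr => e e0; rewrite add0r.
have K1 : 0 < `|K| + 1 by rewrite ltr_wpDl.
apply: le_trans (fg (e / (`|K| + 1)) _) _; first by rewrite divr_gt0.
rewrite mulrCA ler_piMr ?(ltW e0) // ler_pdivrMr // mul1r.
by apply: le_trans (ler_norm _) _; rewrite lerDl.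
Qed.

Lemma hcauchy_cvg x y (u : nat -> homsp H x y) :
  (forall e : R, 0 < e -> exists N, forall m n, (N <= m)%N -> (N <= n)%N ->
     hnorm (u m - u n) < e) ->
  exists l : homsp H x y, forall e : R, 0 < e -> exists N, forall n, (N <= n)%N ->
     hnorm (u n - l) < e.
Proof. by case/(complete H (fun=> I)) => l [_ hl]; exists l. Qed.

End CStarCategory.

(** * Multipliers *)

(** Cancels a norm in estimates [||x||^2 <= k ||x||], including the case [||x|| = 0]. *)
Lemma le_of_sqr_le (R : realType) (a k : R) : 0 <= k -> a * a <= k * a -> a <= k.
Proof. by move=> k0 ak; rewrite leNgt; apply/negP => ka; nra. Qed.

Section Multipliers.
Variables (R : realType) (P : precat R) (H : cstar_cat P).
Implicit Types c d e : obj P.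

Lemma mult_compat c d (m : mhom P c d) : is_mult m ->
  forall x y (g : homsp H d y) (f : homsp H x c), hcomp g (m.1 x f) = hcomp (m.2 y g) f.
Proof. by case=> _ [_ [_ [_ [_ [_ [_ [_ LR]]]]]]] x y g f; exact: LR. Qed.

Lemma mult_compA c d (m : mhom P c d) : is_mult m ->
  forall x y (h : homsp H x c) (f : homsp H y x), m.1 y (hcomp h f) = hcomp (m.1 x h) f.
Proof. by case=> _ [_ [_ [_ [L _]]]] x y h f; exact: L. Qed.

Lemma mult_addL c d (m : mhom P c d) : is_mult m ->
  forall x (h h' : homsp H x c), m.1 x (h + h') = (m.1 x h : homsp H x d) + m.1 x h'.
Proof. by case=> L _ x h h'; exact: L. Qed.

Lemma mult_scaleL c d (m : mhom P c d) : is_mult m ->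
  forall x k (h : homsp H x c), m.1 x (k *: h) = k *: (m.1 x h : homsp H x d).
Proof. by case=> _ [L _] x h h'; exact: L. Qed.

Lemma mult_addR c d (m : mhom P c d) : is_mult m ->
  forall x (h h' : homsp H d x), m.2 x (h + h') = (m.2 x h : homsp H c x) + m.2 x h'.
Proof. by case=> _ [_ [L _]] x h h'; exact: L. Qed.

Lemma mult_scaleR c d (m : mhom P c d) : is_mult m ->
  forall x k (h : homsp H d x), m.2 x (k *: h) = k *: (m.2 x h : homsp H c x).
Proof. by case=> _ [_ [_ [L _]]] x h h'; exact: L. Qed.

Lemma mult_compAR c d (m : mhom P c d) : is_mult m ->
  forall x y (h : homsp H d x) (f : homsp H x y), m.2 y (hcomp f h) = hcomp f (m.2 x h).
Proof. by case=> _ [_ [_ [_ [_ [L _]]]]] x y h f; exact: L. Qed.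

(* The compatibility condition alone forces linearity and the module
   conditions, because [Hom] acts faithfully on itself. *)
Lemma is_multP c d (m : mhom P c d) (K : R) :
  (forall x y (g : homsp H d y) (f : homsp H x c), hcomp g (m.1 x f) = hcomp (m.2 y g) f) ->
  (forall x (h : homsp H x c), hnorm (m.1 x h) <= K * hnorm h) ->
  is_mult m.
Proof.
move=> LR LK; split; last split; last split; last split; last split; last split;
  last split; last split.
- move=> x h h'; apply: (@hcomp_faithful_l _ _ H) => z g.
  by rewrite LR (hcompDr (H := H)) -!LR -(hcompDr (H := H)).
- move=> x a h; apply: (@hcomp_faithful_l _ _ H) => z g.
  by rewrite LR (hcompZr (H := H)) -!LR -(hcompZr (H := H)).
- move=> x h h'; apply: (@hcomp_faithful_r _ _ H) => z g.
  by rewrite -LR (hcompDl (H := H)) !LR -(hcompDl (H := H)).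
- move=> x a h; apply: (@hcomp_faithful_r _ _ H) => z g.
  by rewrite -LR (hcompZl (H := H)) !LR -(hcompZl (H := H)).
- move=> x y h g; apply: (@hcomp_faithful_l _ _ H) => z k.
  by rewrite LR !(hcompA (H := H)) LR.
- move=> x y h g; apply: (@hcomp_faithful_r _ _ H) => z k.
  by rewrite -LR -!(hcompA (H := H)) LR.
- by exists K.
(* With [k = m.2 x h], compatibility rewrites [k k^*] as [h] composed with the image of [k^*] under
   [m.1], whose norm is at most [||h|| |K| ||k||]. *)
- exists `|K| => x h.
  apply: le_of_sqr_le; first by rewrite mulr_ge0 // (hnorm_ge0 (H := H)).
  rewrite -expr2 -(hnorm_comp_star (H := H)) -LR (mulrC `|K|) -mulrA.
  apply: le_trans (hnorm_comp (H := H) _ _) _; rewrite ler_wpM2l ?(hnorm_ge0 (H := H)) //.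
  apply: le_trans (LK _ _) _; rewrite (hnorm_star (H := H)).
  by rewrite ler_wpM2r ?(hnorm_ge0 (H := H)) // ler_norm.
- by move=> x y f g; exact: LR.
Qed.

(** [R] is recovered from [L], because [R(g) f = g L(f)] for all [f] and composition is faithful. *)
Lemma mult_ext c d (m m' : mhom P c d) : is_mult m -> is_mult m' ->
  (forall x (h : homsp H x c), m.1 x h = m'.1 x h) -> m = m'.
Proof.
move=> mm mm' mm1; rewrite [m]surjective_pairing [m']surjective_pairing.
congr pair; apply: functional_extensionality_dep => x; apply: funext => h; first exact: mm1.
apply: (@hcomp_faithful_r _ _ H) => z g.
by rewrite -(mult_compat mm) mm1 (mult_compat mm').
Qed.

Section Norm.
Variables (c d : obj P) (m : mhom P c d).
Hypothesis mm : is_mult m.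

Lemma fam_normLE : fam_normL m.1 =
  @sup_op_norm R (obj P) (fun x => homsp H x c) (fun x => homsp H x d)
    (fun x => @hnorm R P x c) (fun x => @hnorm R P x d) m.1.
Proof. by []. Qed.

Lemma fam_normRE : fam_normR m.2 =
  @sup_op_norm R (obj P) (fun x => homsp H d x) (fun x => homsp H c x)
    (fun x => @hnorm R P d x) (fun x => @hnorm R P c x) m.2.
Proof. by []. Qed.

Lemma le_fam_normL x (h : homsp H x c) : hnorm (m.1 x h) <= fam_normL m.1 * hnorm h.
Proof.
rewrite fam_normLE; apply: (le_sup_op_norm (A := fun x => homsp H x c) (B := fun x => homsp H x d)).
- by move=> ? ?; exact: (hnorm_ge0 (H := H)).
- by move=> ? ? ?; exact: hnormZ.
- by move=> ? ? ?; exact: hnormZ.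
- exact: mult_scaleL.
- by case: mm => _ [_ [_ [_ [_ [_ [[K LK] _]]]]]]; exists K.
Qed.

Lemma le_fam_normR x (h : homsp H d x) : hnorm (m.2 x h) <= fam_normR m.2 * hnorm h.
Proof.
rewrite fam_normRE; apply: (le_sup_op_norm (A := fun x => homsp H d x) (B := fun x => homsp H c x)).
- by move=> ? ?; exact: (hnorm_ge0 (H := H)).
- by move=> ? ? ?; exact: hnormZ.
- by move=> ? ? ?; exact: hnormZ.
- exact: mult_scaleR.
- by case: mm => _ [_ [_ [_ [_ [_ [_ [[K LK] _]]]]]]]; exists K.
Qed.

Lemma fam_normL_le K : 0 <= K ->
  (forall x (h : homsp H x c), hnorm (m.1 x h) <= K * hnorm h) -> fam_normL m.1 <= K.
Proof.
move=> K0 mK; rewrite fam_normLE.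
apply: (sup_op_norm_le (A := fun x => homsp H x c) (B := fun x => homsp H x d)) => //.
by move=> ? ? ?; exact: hnormZ.
Qed.

Lemma fam_normR_le K : 0 <= K ->
  (forall x (h : homsp H d x), hnorm (m.2 x h) <= K * hnorm h) -> fam_normR m.2 <= K.
Proof.
move=> K0 mK; rewrite fam_normRE.
apply: (sup_op_norm_le (A := fun x => homsp H d x) (B := fun x => homsp H c x)) => //.
by move=> ? ? ?; exact: hnormZ.
Qed.

Lemma fam_normL_ge0 : 0 <= fam_normL m.1.
Proof.
rewrite fam_normLE; apply: (sup_op_norm_ge0 (A := fun x => homsp H x c) (B := fun x => homsp H x d)).
- by move=> ? ?; exact: (hnorm_ge0 (H := H)).
- by move=> ? ?; exact: (hnorm_ge0 (H := H)).
- by move=> ? ? ?; exact: hnormZ.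
- by case: mm => _ [_ [_ [_ [_ [_ [[K LK] _]]]]]]; exists K.
- by constructor.
Qed.

Lemma fam_normR_ge0 : 0 <= fam_normR m.2.
Proof.
rewrite fam_normRE; apply: (sup_op_norm_ge0 (A := fun x => homsp H d x) (B := fun x => homsp H c x)).
- by move=> ? ?; exact: (hnorm_ge0 (H := H)).
- by move=> ? ?; exact: (hnorm_ge0 (H := H)).
- by move=> ? ? ?; exact: hnormZ.
- by case: mm => _ [_ [_ [_ [_ [_ [_ [[K LK] _]]]]]]]; exists K.
- by constructor.
Qed.

(** With [k = (L h)^*] one has [||L h||^2 = ||R(k) h|| <= ||R|| ||L h|| ||h||], and symmetrically
    for [R]. *)
Lemma fam_normLR : fam_normL m.1 = fam_normR m.2.
Proof.
apply/eqP; rewrite eq_le; apply/andP; split.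
  apply: fam_normL_le => [|x h]; first exact: fam_normR_ge0.
  apply: le_of_sqr_le.
    by rewrite mulr_ge0 ?fam_normR_ge0 // (hnorm_ge0 (H := H)).
  rewrite -expr2 -(hnorm_star_comp (H := H)) (mult_compat mm).
  apply: le_trans (hnorm_comp (H := H) _ _) _.
  rewrite [leRHS]mulrAC ler_wpM2r ?(hnorm_ge0 (H := H)) //.
  by apply: le_trans (le_fam_normR _) _; rewrite (hnorm_star (H := H)).
apply: fam_normR_le => [|x h]; first exact: fam_normL_ge0.
apply: le_of_sqr_le.
  by rewrite mulr_ge0 ?fam_normL_ge0 // (hnorm_ge0 (H := H)).
rewrite -expr2 -(hnorm_comp_star (H := H)) -(mult_compat mm).
apply: le_trans (hnorm_comp (H := H) _ _) _.
rewrite (mulrC (fam_normL _)) -mulrA ler_wpM2l ?(hnorm_ge0 (H := H)) //.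
by apply: le_trans (le_fam_normL _) _; rewrite (hnorm_star (H := H)).
Qed.
End Norm.
End Multipliers.

(** * Operations, norm and completeness of multipliers *)

Section MultiplierCategory.
Variables (R : realType) (P : precat R) (H : cstar_cat P).
Implicit Types c d : obj P.

Lemma mnormE c d (m : chom (MC P) c d) : is_mult m -> hnorm m = fam_normL m.1.
Proof. by move=> mm; rewrite /= /mnorm -(fam_normLR H mm) maxxx. Qed.

Lemma mnorm_ge0 c d (m : chom (MC P) c d) : is_mult m -> 0 <= hnorm m.
Proof. by move=> mm; rewrite mnormE //; exact: (fam_normL_ge0 H mm). Qed.

Lemma le_mnorm c d (m : chom (MC P) c d) : is_mult m ->
  forall x (h : homsp H x c), hnorm (m.1 x h) <= hnorm m * hnorm h.
Proof. by move=> mm x h; rewrite mnormE //; exact: (le_fam_normL mm). Qed.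

Lemma le_mnormR c d (m : chom (MC P) c d) : is_mult m ->
  forall x (h : homsp H d x), hnorm (m.2 x h) <= hnorm m * hnorm h.
Proof.
move=> mm x h; rewrite mnormE // (fam_normLR H mm); exact: (le_fam_normR mm).
Qed.

Lemma mnorm_le c d (m : chom (MC P) c d) K : is_mult m -> 0 <= K ->
  (forall x (h : homsp H x c), hnorm (m.1 x h) <= K * hnorm h) -> hnorm m <= K.
Proof. by move=> mm K0 mK; rewrite mnormE //; exact: (fam_normL_le (H := H)). Qed.

Lemma is_mult0 c d : is_mult (hzero : chom (MC P) c d).
Proof.
apply: (@is_multP _ _ H _ _ _ 0) => /= [x y g f|x h].
  by rewrite (hcomp0l (H := H)) (hcomp0r (H := H)).
by rewrite (hnorm0 H) mul0r.
Qed.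

Lemma is_multD c d (m m' : chom (MC P) c d) :
  is_mult m -> is_mult m' -> is_mult (hadd m m' : chom (MC P) c d).
Proof.
move=> mm mm'; apply: (@is_multP _ _ H _ _ _ (hnorm m + hnorm m')) => /= [x y g f|x h].
  by rewrite (hcompDl (H := H)) (hcompDr (H := H)) !(mult_compat (H := H)).
apply: le_trans (hnormD (H := H) _ _) _; rewrite mulrDl.
by apply: lerD; exact: le_mnorm.
Qed.

Lemma is_multZ c d k (m : chom (MC P) c d) :
  is_mult m -> is_mult (hscale k m : chom (MC P) c d).
Proof.
move=> mm; apply: (@is_multP _ _ H _ _ _ (Normc.normc k * hnorm m)) => /= [x y g f|x h].
  by rewrite (hcompZl (H := H)) (hcompZr (H := H)) !(mult_compat (H := H)).
rewrite (hnormZ (H := H)) -mulrA ler_wpM2l //; last exact: le_mnorm.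
by case: k => a b; exact: sqrtr_ge0.
Qed.

Lemma is_mult_comp c d e (m' : chom (MC P) d e) (m : chom (MC P) c d) :
  is_mult m' -> is_mult m -> is_mult (hcomp m' m : chom (MC P) c e).
Proof.
move=> mm' mm; apply: (@is_multP _ _ H _ _ _ (hnorm m' * hnorm m)) => /= [x y g f|x h].
  by rewrite (mult_compat (H := H) mm') (mult_compat (H := H) mm).
apply: le_trans (le_mnorm mm' _) _; rewrite -mulrA ler_wpM2l ?mnorm_ge0 //.
exact: le_mnorm.
Qed.

Lemma is_mult_star c d (m : chom (MC P) c d) :
  is_mult m -> is_mult (hstar m : chom (MC P) d c).
Proof.
move=> mm; apply: (@is_multP _ _ H _ _ _ (hnorm m)) => /= [x y g f|x h].
  have := congr1 hstar (mult_compat (H := H) mm (hstar f) (hstar g)).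
  by rewrite !(hstar_comp (H := H)) !(hstarK (H := H)).
rewrite (hnorm_star (H := H)); apply: le_trans (le_mnormR mm _) _.
by rewrite (hnorm_star (H := H)).
Qed.

Definition mid c : chom (MC P) c c := (fun E h => h, fun E h => h).

Lemma is_mult_id c : is_mult (mid c).
Proof. by apply: (@is_multP _ _ H _ _ _ 1) => //= x h; rewrite mul1r. Qed.

Lemma mhom_ext c d (m m' : mhom P c d) :
  (forall x h, m.1 x h = m'.1 x h) -> (forall x h, m.2 x h = m'.2 x h) -> m = m'.
Proof.
move=> h1 h2; rewrite [m]surjective_pairing [m']surjective_pairing.
by congr pair; apply: functional_extensionality_dep => x; apply: funext => h.
Qed.

Lemma mnorm_eq0 c d (m : chom (MC P) c d) : is_mult m -> hnorm m = 0 -> m = hzero.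
Proof.
move=> mm m0; apply: (mult_ext (H := H) mm (@is_mult0 c d)) => x h /=.
apply: (hnorm_eq0 (H := H)); apply/eqP; rewrite eq_le (hnorm_ge0 (H := H)) andbT.
by rewrite -(mul0r (hnorm h)) -m0; exact: le_mnorm.
Qed.

Lemma mnormD c d (m m' : chom (MC P) c d) : is_mult m -> is_mult m' ->
  hnorm (hadd m m') <= hnorm m + hnorm m'.
Proof.
move=> mm mm'; apply: mnorm_le => [||x h]; first exact: is_multD.
  by rewrite addr_ge0 // mnorm_ge0.
apply: le_trans (hnormD (H := H) _ _) _; rewrite mulrDl.
by apply: lerD; exact: le_mnorm.
Qed.

Lemma mnorm_comp c d e (m' : chom (MC P) d e) (m : chom (MC P) c d) :
  is_mult m' -> is_mult m -> hnorm (hcomp m' m) <= hnorm m' * hnorm m.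
Proof.
move=> mm' mm; apply: mnorm_le => [||x h]; first exact: is_mult_comp.
  by rewrite mulr_ge0 // mnorm_ge0.
apply: le_trans (le_mnorm mm' _) _; rewrite -mulrA ler_wpM2l ?mnorm_ge0 //.
exact: le_mnorm.
Qed.

Lemma mscaleA c d a b (m : chom (MC P) c d) : hscale a (hscale b m) = hscale (a * b) m.
Proof. by apply: mhom_ext => x h; exact: (Defs.scaleA H _ _ I). Qed.

Lemma mscale1 c d (m : chom (MC P) c d) : hscale 1 m = m.
Proof. by apply: mhom_ext => x h; exact: (Defs.scale1 H I). Qed.

(** The pointwise bound gives [<=]; applied to [k^-1] and [hscale k m] it gives the reverse
    inequality when [k <> 0]. *)
Lemma mnormZ c d k (m : chom (MC P) c d) : is_mult m ->
  hnorm (hscale k m) = Normc.normc k * hnorm m.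
Proof.
have normc_ge0 k' : 0 <= Normc.normc k' :> R by case: k' => a b; exact: sqrtr_ge0.
have le k' (m' : chom (MC P) c d) : is_mult m' ->
    hnorm (hscale k' m') <= Normc.normc k' * hnorm m'.
  move=> mm; apply: mnorm_le => [||x h]; first exact: is_multZ.
    by rewrite mulr_ge0 // mnorm_ge0.
  by rewrite (hnormZ (H := H)) -mulrA ler_wpM2l //; exact: le_mnorm.
move=> mm; apply/eqP; rewrite eq_le le //=.
have [->|k0] := eqVneq k 0; first by rewrite Normc.normc0 mul0r; apply/mnorm_ge0/is_multZ.
have nk : Normc.normc k != 0 by apply: contra k0 => /eqP /Normc.eq0_normc ->.
rewrite -ler_pdivlMl ?lt_neqAle ?normc_ge0 1?eq_sym ?nk //.
rewrite -Normc.normcV -{1}(mscale1 m) -(mulVf k0) -mscaleA.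
by apply: le; exact: is_multZ.
Qed.

(** For [>=], the C*-identity downstairs gives [||L h||^2 <= ||m^* m|| ||h||^2], so the square root
    of [||m^* m||] bounds [L]. *)
Lemma mnorm_star_comp c d (m : chom (MC P) c d) : is_mult m ->
  hnorm (hcomp (hstar m) m) = hnorm m ^+ 2.
Proof.
move=> mm; have mm' := is_mult_star mm; have mmm := is_mult_comp mm' mm.
have star_le c' d' (m' : chom (MC P) c' d') : is_mult m' -> hnorm (hstar m') <= hnorm m'.
  move=> km; apply: mnorm_le => [||x h]; [exact: is_mult_star | exact: mnorm_ge0 |].
  rewrite (hnorm_star (H := H)); apply: le_trans (le_mnormR km _) _.
  by rewrite (hnorm_star (H := H)).
apply/eqP; rewrite eq_le; apply/andP; split.
  apply: le_trans (mnorm_comp mm' mm) _; rewrite expr2 ler_wpM2r ?mnorm_ge0 //.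
  exact: star_le.
rewrite -(sqr_sqrtr (mnorm_ge0 mmm)) ler_pXn2r ?nnegrE ?mnorm_ge0 ?sqrtr_ge0 //.
apply: mnorm_le => [||x h]; rewrite ?sqrtr_ge0 //.
rewrite -(@ler_pXn2r _ 2) ?nnegrE ?mulr_ge0 ?sqrtr_ge0 ?(hnorm_ge0 (H := H)) //.
rewrite exprMn sqr_sqrtr ?mnorm_ge0 // -(hnorm_star_comp (H := H)).
rewrite (mult_compat (H := H) mm).
have -> : m.2 x (hstar (m.1 x h)) = hstar ((hcomp (hstar m) m : chom (MC P) c c).1 x h).
  by rewrite /= (hstarK (H := H)).
apply: le_trans (hnorm_comp (H := H) _ _) _.
rewrite (hnorm_star (H := H)) expr2 mulrA ler_wpM2r ?(hnorm_ge0 (H := H)) //.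
exact: (le_mnorm mmm).
Qed.

Lemma mcauchy_cvg c d (u : nat -> chom (MC P) c d) : (forall n, is_mult (u n)) ->
  (forall e : R, 0 < e -> exists N, forall m n, (N <= m)%N -> (N <= n)%N ->
     hnorm (hsub (u m) (u n)) < e) ->
  exists l : chom (MC P) c d, is_mult l /\
    (forall e : R, 0 < e -> exists N, forall n, (N <= n)%N -> hnorm (hsub (u n) l) < e).
Proof.
move=> mu cu.
have mB (m m' : chom (MC P) c d) : is_mult m -> is_mult m' -> is_mult (hsub m m' : chom (MC P) c d).
  by move=> mm mm'; apply: is_multD => //; exact: is_multZ.
have uL x (h : homsp H x c) m n : hnorm (((u m).1 x h : homsp H x d) - ((u n).1 x h : homsp H x d))
    <= hnorm (hsub (u m) (u n)) * hnorm h by apply: (le_mnorm (mB _ _ (mu m) (mu n)) h).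
have uR x (h : homsp H d x) m n : hnorm (((u m).2 x h : homsp H c x) - ((u n).2 x h : homsp H c x))
    <= hnorm (hsub (u m) (u n)) * hnorm h by apply: (le_mnormR (mB _ _ (mu m) (mu n)) h).
(* Both families converge pointwise; [cid] selects the limits, so that they assemble into
   functions. *)
have cvg x y (v : nat -> homsp H x y) (K : R) : 0 <= K ->
    (forall m n, hnorm (v m - v n) <= hnorm (hsub (u m) (u n)) * K) ->
    {l : homsp H x y | forall e : R, 0 < e -> exists N, forall n, (N <= n)%N -> hnorm (v n - l) < e}.
  move=> K0 vu; apply: cid; apply: hcauchy_cvg => e e0.
  have K1 : 0 < K + 1 by rewrite ltr_wpDl.
  have [|N hN] := cu (e / (K + 1)); first by rewrite divr_gt0.
  exists N => m n Nm Nn; apply: le_lt_trans (vu _ _) _.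
  have := hN _ _ Nm Nn; rewrite ltr_pdivlMr //.
  have := mnorm_ge0 (mB _ _ (mu m) (mu n)); nra.
pose L x (h : homsp H x c) := cvg _ _ _ _ (hnorm_ge0 h) (uL x h).
pose Rf x (h : homsp H d x) := cvg _ _ _ _ (hnorm_ge0 h) (uR x h).
pose l : chom (MC P) c d := (fun x h => sval (L x h), fun x h => sval (Rf x h)).
(* The Cauchy estimates pass to the limit with an [N] independent of [x] and [h]. *)
have close (e : R) : 0 < e -> exists N, forall n, (N <= n)%N ->
    (forall x (h : homsp H x c), hnorm (((u n).1 x h : homsp H x d) - (l.1 x h : homsp H x d)) <= e * hnorm h)
    /\ (forall x (h : homsp H d x), hnorm (((u n).2 x h : homsp H c x) - (l.2 x h : homsp H c x)) <= e * hnorm h).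
  move=> e0; have [N hN] := cu _ e0; exists N => n Nn; split=> x h.
    apply/ler_addgt0Pr => e' /(svalP (L x h))[N' hN'].
    have := hN' _ (leq_maxr N N'); have := uL x h n (maxn N N').
    have := hN _ _ Nn (leq_maxl N N'); have := hnorm_ge0 h.
    have := hdist_triangle ((u (maxn N N')).1 x h : homsp H x d) ((u n).1 x h) (l.1 x h).
    rewrite [l.1 x h]/=; nra.
  apply/ler_addgt0Pr => e' /(svalP (Rf x h))[N' hN'].
  have := hN' _ (leq_maxr N N'); have := uR x h n (maxn N N').
  have := hN _ _ Nn (leq_maxl N N'); have := hnorm_ge0 h.
  have := hdist_triangle ((u (maxn N N')).2 x h : homsp H c x) ((u n).2 x h) (l.2 x h).
  rewrite [l.2 x h]/=; nra.
have ml : is_mult l.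
  (* Distance [1] from a single [u N] makes [l] bounded; compatibility holds up to [2 ||g|| ||f|| e]
     for every [e > 0], hence exactly. *)
  have [N hN] := close _ ltr01.
  apply: (@is_multP _ _ H _ _ _ (hnorm (u N) + 1)) => [x y g f|x h].
    apply: (@hdist_eq0 _ _ H _ _ _ _ (2 * hnorm g * hnorm f)) => e e0.
    have [N' /(_ _ (leqnn _))[/(_ _ f) hL /(_ _ g) hR]] := close _ e0.
    apply: le_trans (hdist_triangle (hcomp g ((u N').1 x f) : homsp H x y) _ _) _.
    have -> : 2 * hnorm g * hnorm f * e = hnorm g * (e * hnorm f) + e * hnorm g * hnorm f.
      by ring.
    apply: lerD.
      rewrite -(hcompBr (H := H)); apply: le_trans (hnorm_comp (H := H) _ _) _.
      by rewrite ler_wpM2l ?(hnorm_ge0 (H := H)) // (hdistC (H := H)).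
    rewrite (mult_compat (H := H) (mu N')) -(hcompBl (H := H)).
    apply: le_trans (hnorm_comp (H := H) _ _) _.
    by rewrite ler_wpM2r ?(hnorm_ge0 (H := H)).
  have [/(_ _ h) hL _] := hN _ (leqnn _).
  have := hnormD (H := H) (((l.1 x h : homsp H x d) - ((u N).1 x h : homsp H x d))) ((u N).1 x h).
  rewrite subrK (hdistC (H := H)) mulrDl mul1r => h1; apply: le_trans h1 _.
  rewrite addrC; apply: lerD; first exact: le_mnorm.
  by rewrite mul1r in hL.
exists l; split=> // e e0; have e20 : 0 < e / 2 by rewrite divr_gt0.
have [N hN] := close _ e20; exists N => n /hN[hL _].
apply: (@le_lt_trans _ _ (e / 2)); last by lra.
apply: mnorm_le => [||x h]; [exact: mB | exact: ltW | exact: hL].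
Qed.

End MultiplierCategory.

(** * Morphisms as multipliers *)

Section Inclusion.
Variables (R : realType) (P : precat R) (H : cstar_cat P).

Lemma is_mult_incl c d (f : chom P c d) : is_mult (incl f).
Proof.
apply: (@is_multP _ _ H _ _ _ (hnorm f)) => [x y g k|x h].
  exact: (hcompA (H := H)).
exact: (hnorm_comp (H := H)).
Qed.

Lemma inclD c d (f g : homsp H c d) : incl (f + g) = hadd (incl f) (incl g).
Proof.
by apply: mhom_ext => x h; [exact: (hcompDl (H := H))|exact: (hcompDr (H := H))].
Qed.

Lemma inclZ c d k (f : homsp H c d) : incl (k *: f) = hscale k (incl f).
Proof.
by apply: mhom_ext => x h; [exact: (hcompZl (H := H))|exact: (hcompZr (H := H))].
Qed.

Lemma incl_comp c d e (g : homsp H d e) (f : homsp H c d) :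
  incl (hcomp g f) = hcomp (incl g) (incl f).
Proof.
apply: mhom_ext => x h /=; first by rewrite -(hcompA (H := H)).
by rewrite (hcompA (H := H)).
Qed.

Lemma incl_star c d (f : homsp H c d) : incl (hstar f) = hstar (incl f).
Proof.
by apply: mhom_ext => x h /=; rewrite (hstar_comp (H := H)) (hstarK (H := H)).
Qed.

Lemma incl_inj c d (f g : homsp H c d) : incl f = incl g -> f = g.
Proof.
move=> fg; apply: (@hcomp_faithful_r _ _ H) => z h.
exact: (congr1 (fun m : mhom P c d => m.1 z h) fg).
Qed.

(** For the lower bound, testing on [f^*] gives [||f||^2 = ||f f^*|| <= ||incl f|| ||f||]. *)
Lemma mnorm_incl c d (f : homsp H c d) : hnorm (incl f) = hnorm f.
Proof.
apply/eqP; rewrite eq_le; apply/andP; split.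
  apply: (mnorm_le (H := H)) => [||x h]; first exact: is_mult_incl.
    exact: (hnorm_ge0 (H := H)).
  exact: (hnorm_comp (H := H)).
apply: le_of_sqr_le; first by apply: (mnorm_ge0 H); exact: is_mult_incl.
rewrite -expr2 -(hnorm_comp_star (H := H)) -[X in _ * X](hnorm_star (H := H)).
exact: (le_mnorm (H := H) (is_mult_incl f)).
Qed.

Lemma mcomp_incl c d e (m : chom (MC P) d e) (f : homsp H c d) : is_mult m ->
  hcomp m (incl f) = incl (m.1 _ f).
Proof.
move=> mm; apply: mhom_ext => x h /=; first exact: (mult_compA (H := H)).
by rewrite (mult_compat (H := H) mm).
Qed.

Lemma incl_mcomp c d e (m : chom (MC P) c d) (f : homsp H d e) : is_mult m ->
  hcomp (incl f) m = incl (m.2 _ f).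
Proof.
move=> mm; apply: mhom_ext => x h /=; first by rewrite (mult_compat (H := H) mm).
exact: (mult_compAR (H := H)).
Qed.

End Inclusion.

(** * The unital C*-algebra of endomorphism multipliers *)

Section MultiplierAlgebra.
Variables (R : realType) (P : precat R) (H : cstar_cat P) (c : obj P).
(* MathComp algebras are nontrivial; the zero algebra is treated separately. *)
Hypothesis id_neq0 : mid c <> hzero.

(** Both proofs are arguments of the type because the instances declared on it depend on them. *)
Definition malg (_ : cstar_cat P) (_ : mid c <> hzero) : Type :=
  {m : chom (MC P) c c | is_mult m}.
Notation M := (malg H id_neq0).

Lemma malg_ext (m m' : M) : sval m = sval m' -> m = m'.
Proof. by case: m m' => [m mm] [m' mm'] /=; exact: eq_exist. Qed.

Definition malg_mk m (mm : is_mult m) : M := exist _ m mm.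
Let zero : M := malg_mk (is_mult0 H c c).
Let one : M := malg_mk (is_mult_id H c).
Let add (m m' : M) : M := malg_mk (is_multD H (svalP m) (svalP m')).
Let scale k (m : M) : M := malg_mk (is_multZ H k (svalP m)).
Let mul (m m' : M) : M := malg_mk (is_mult_comp H (svalP m) (svalP m')).
Let star (m : M) : M := malg_mk (is_mult_star H (svalP m)).

Let addA : associative add.
Proof. by move=> m n p; apply/malg_ext/mhom_ext => x h; exact: (Defs.addA H I I I). Qed.
Let addC : commutative add.
Proof. by move=> m n; apply/malg_ext/mhom_ext => x h; exact: (Defs.addC H I I). Qed.
Let add0r : left_id zero add.
Proof. by move=> m; apply/malg_ext/mhom_ext => x h; exact: (@GRing.add0r (homsp H _ _)). Qed.
Let addNr : left_inverse zero (scale (-1)) add.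
Proof. by move=> m; apply/malg_ext/mhom_ext => x h; exact: (@GRing.addNr (homsp H _ _)). Qed.

HB.instance Definition _ := gen_eqMixin M.
HB.instance Definition _ := gen_choiceMixin M.
HB.instance Definition _ := GRing.isZmodule.Build M addA addC add0r addNr.

Let mulA : associative mul.
Proof. by move=> m n p; exact: malg_ext. Qed.
Let mul1r : left_id one mul.
Proof. by move=> m; apply/malg_ext/mhom_ext. Qed.
Let mulr1 : right_id one mul.
Proof. by move=> m; apply/malg_ext/mhom_ext. Qed.
Let mulDl : left_distributive mul add.
Proof.
move=> m n p; apply/malg_ext/mhom_ext => x h //=.
exact: (mult_addR (H := H) (svalP p)).
Qed.
Let mulDr : right_distributive mul add.
Proof.
move=> m n p; apply/malg_ext/mhom_ext => x h //=.
exact: (mult_addL (H := H) (svalP m)).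
Qed.
Let one_neq0 : one != zero.
Proof. by apply/eqP => /(congr1 sval); exact: id_neq0. Qed.

HB.instance Definition _ := GRing.Zmodule_isNzRing.Build M
  mulA mul1r mulr1 mulDl mulDr one_neq0.

Let scaleA a b m : scale a (scale b m) = scale (a * b) m.
Proof. by apply/malg_ext/(mscaleA H). Qed.
Let scale1r : left_id 1 scale.
Proof. by move=> m; apply/malg_ext/(mscale1 H). Qed.
Let scaleDr : right_distributive scale +%R.
Proof. by move=> k m n; apply/malg_ext/mhom_ext => x h; exact: (Defs.scaleDr H _ I I). Qed.
Let scaleDl m : {morph scale^~ m : a b / a + b}.
Proof. by move=> a b; apply/malg_ext/mhom_ext => x h; exact: (Defs.scaleDl H _ _ I). Qed.

HB.instance Definition _ := GRing.Zmodule_isLmodule.Build R[i] M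
  scaleA scale1r scaleDr scaleDl.

Let scaleAl k (m n : M) : k *: (m * n) = (k *: m) * n.
Proof.
apply/malg_ext/mhom_ext => x h //=.
by apply/esym; exact: (mult_scaleR (H := H) (svalP n)).
Qed.
HB.instance Definition _ := GRing.Lmodule_isLalgebra.Build R[i] M scaleAl.
Let scaleAr k (m n : M) : k *: (m * n) = m * (k *: n).
Proof.
apply/malg_ext/mhom_ext => x h //=.
by apply/esym; exact: (mult_scaleL (H := H) (svalP m)).
Qed.
HB.instance Definition _ := GRing.Lalgebra_isAlgebra.Build R[i] M scaleAr.

Let norm (m : M) : R := hnorm (sval m).
Let norm_ge0 m : 0 <= norm m.
Proof. exact: (mnorm_ge0 H (svalP m)). Qed.
Let norm_eq0 m : norm m = 0 -> m = 0.
Proof. by move=> m0; apply/malg_ext/(mnorm_eq0 H (svalP m)). Qed.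
Let normZ k m : norm (k *: m) = Normc.normc k * norm m.
Proof. exact: (mnormZ H k (svalP m)). Qed.
Let normD m n : norm (m + n) <= norm m + norm n.
Proof. exact: (mnormD H (svalP m) (svalP n)). Qed.
Let normM m n : norm (m * n) <= norm m * norm n.
Proof. exact: (mnorm_comp H (svalP m) (svalP n)). Qed.
Let starD m n : star (m + n) = star m + star n.
Proof. by apply/malg_ext/mhom_ext => x h; exact: (Defs.starD H I I). Qed.
Let starZ k m : star (k *: m) = conjc k *: star m.
Proof. by apply/malg_ext/mhom_ext => x h; exact: (Defs.starZ H _ I). Qed.
Let starK : involutive star.
Proof. by move=> m; apply/malg_ext/mhom_ext => x h /=; rewrite !(hstarK (H := H)). Qed.
Let starM m n : star (m * n) = star n * star m.
Proof. by apply/malg_ext/mhom_ext => x h /=; rewrite !(hstarK (H := H)). Qed.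
Let norm_starM m : norm (star m * m) = norm m ^+ 2.
Proof. exact: (mnorm_star_comp H (svalP m)). Qed.
Let cvg (u : nat -> M) :
  (forall e : R, 0 < e -> exists N, forall m n, (N <= m)%N -> (N <= n)%N ->
     norm (u m - u n) < e) ->
  exists l, forall e : R, 0 < e -> exists N, forall n, (N <= n)%N -> norm (u n - l) < e.
Proof.
by move=> /(mcauchy_cvg H (fun n => svalP (u n)))[l [ml ul]]; exists (malg_mk ml).
Qed.

HB.instance Definition _ := isCStarAlgebra.Build R M norm_ge0 norm_eq0 normZ
  normD normM starD starZ starK starM norm_starM cvg.

End MultiplierAlgebra.

(** * Positivity in the multiplier category *)

Section StarPositivity.
Variables (R : realType) (P : precat R) (H : cstar_cat P).

(** Settles the case excluded from [malg]: every [h] into [c] is then zero, and [m] is linear. *)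
Lemma mid_eq0 (c : obj P) : mid c = hzero -> forall d (m : chom (MC P) c d), is_mult m -> m = hzero.
Proof.
move=> id0 d m mm; apply: (mult_ext (H := H) mm (is_mult0 H c d)) => x h /=.
have -> : h = (hzero : homsp H x c).
  exact: (congr1 (fun k : mhom P c c => k.1 x h) id0).
by rewrite -[hzero](scale0r (0 : homsp H x c)) (mult_scaleL mm) scale0r.
Qed.

(** Endomorphisms of [x] may form an algebra without unit, so the sum is pushed along [incl] into
    the unital algebra [malg], where [starM_add_eq0] applies. *)
Lemma hstar_comp_add_eq0 x (g k : homsp H x x) :
  (hcomp (hstar g) g : homsp H x x) + (hcomp (hstar k) k : homsp H x x) = 0 -> g = 0.
Proof.
move=> gk; apply: (incl_inj (H := H)).
have incl0 : incl (0 : homsp H x x) = hzero.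
  by apply: mhom_ext => y h; [exact: hcomp0l|exact: hcomp0r].
have [id0|id_neq0] := pselect (mid x = hzero).
  by rewrite incl0; exact: mid_eq0 id0 _ _ (is_mult_incl H g).
pose G : malg H id_neq0 := malg_mk H id_neq0 (is_mult_incl H g).
pose K : malg H id_neq0 := malg_mk H id_neq0 (is_mult_incl H k).
suff : G = 0 by move=> /(congr1 sval); rewrite incl0.
apply: (@starM_add_eq0 _ _ G K); apply: malg_ext.
have := congr1 (@incl R P x x) gk; rewrite incl0 (inclD (H := H)).
by rewrite !(incl_comp (H := H)) !(incl_star (H := H)).
Qed.

(** The axiom [star_pos] of the original category replaces [f] and [k] by endomorphisms of [x] with
    the same [f^* f] and [k^* k]. *)
Lemma hstar_comp_add_eq0_hom x y z (f : homsp H x y) (k : homsp H x z) :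
  (hcomp (hstar f) f : homsp H x x) + (hcomp (hstar k) k : homsp H x x) = 0 -> f = 0.
Proof.
have [g [_ fg]] := star_pos H (f := f) I; have [h [_ kh]] := star_pos H (f := k) I.
rewrite [hcomp (hstar f) f]fg [hcomp (hstar k) k]kh => /hstar_comp_add_eq0 g0.
apply: (hnorm_eq0 (H := H)); apply/eqP; rewrite -sqrf_eq0 -(hnorm_star_comp (H := H)).
by rewrite fg g0 (hcomp0r (H := H)) (hnorm0 H).
Qed.

Lemma mult_star_comp (c d : obj P) (m : chom (MC P) c d) : is_mult m -> forall x (h : homsp H x c),
  hcomp (hstar (m.1 x h)) (m.1 x h) =
  hcomp (hstar ((hcomp (hstar m) m : chom (MC P) c c).1 x h)) h.
Proof. by move=> mm x h; rewrite /= (hstarK (H := H)) (mult_compat (H := H) mm). Qed.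

(** The analogue of [starM_eq_opp_sqr] for a [t] between different objects. Evaluated at [h], the
    relation says that [(t h)^* (t h) + (q h)^* (q h) = 0], so each [t h] vanishes. *)
Lemma mult_star_comp_eq_opp (c d : obj P) (t : chom (MC P) c d) (q : chom (MC P) c c) :
  is_mult t -> is_mult q ->
  hcomp (hstar t) t = hscale (-1) (hcomp (hstar q) q) -> t = hzero.
Proof.
move=> tm qm tq; apply: (mult_ext (H := H) tm (is_mult0 H c d)) => x h /=.
apply: (@hstar_comp_add_eq0_hom _ _ _ _ (q.1 x h)).
rewrite (mult_star_comp tm) (mult_star_comp qm) -(hcompDl (H := H)) -(hstarD (H := H)).
have neg (f : homsp H x c) : (hscale (-1) f : homsp H x c) + f = 0 by exact: addNr.
rewrite tq /= neg.
by rewrite (hstar0 H) (hcomp0l (H := H)).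
Qed.

Lemma mult_star_pos (c d : obj P) (m : chom (MC P) c d) : is_mult m ->
  exists g : chom (MC P) c c, is_mult g /\ hcomp (hstar m) m = hcomp (hstar g) g.
Proof.
move=> mm; have mm' := is_mult_star H mm; have mmm := is_mult_comp H mm' mm.
have [id0|id_neq0] := pselect (mid c = hzero).
  exists hzero; split; first exact: is_mult0.
  rewrite (mid_eq0 id0 mmm); apply/esym; apply: (mid_eq0 id0).
  by apply: (is_mult_comp H); [apply: (is_mult_star H)|]; exact: is_mult0.
pose a : malg H id_neq0 := malg_mk H id_neq0 mmm.
have a_sa : a^* = a.
  by apply/malg_ext/mhom_ext => x h /=; rewrite !(hstarK (H := H)).
(* The self-adjoint root serves as [g], since [s s = s^* s]. *)
suff [s s_sa as2] : positive a.
  exists (sval s); split; first exact: svalP.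
  by rewrite -[LHS]/(sval a) as2 -{1}s_sa.
apply: positive_criterion => // p q p_sa q_sa.
pose t : chom (MC P) c d := hcomp m (sval p).
have tm : is_mult t by apply: (is_mult_comp H) => //; exact: svalP.
have tt : hcomp (hstar t) t = sval (p * a * p).
  by rewrite -{1}p_sa; apply: mhom_ext => x h /=; rewrite !(hstarK (H := H)).
move=> paq; apply: malg_ext; rewrite -tt (mult_star_comp_eq_opp tm (svalP q)).
  by apply: mhom_ext => x h //=; exact: (hstar0 H).
by rewrite tt paq -{1}q_sa.
Qed.

Theorem MC_cstar : is_cstar_on (MC P) (@is_mult R P).
Proof.
split.
- by move=> x y; exact: is_mult0.
- by move=> x y f g; exact: is_multD.
- by move=> x y a f; exact: is_multZ.
- by move=> x y z g f; exact: is_mult_comp.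
- by move=> x y f; exact: is_mult_star.
- by move=> x y f g h _ _ _; apply: mhom_ext => w k; exact: (Defs.addA H I I I).
- by move=> x y f g _ _; apply: mhom_ext => w k; exact: (Defs.addC H I I).
- by move=> x y f _; apply: mhom_ext => w k; exact: (Defs.add0 H I).
- by move=> x y f _; apply: mhom_ext => w k; exact: (Defs.addN H I).
- by move=> x y f _; exact: mscale1.
- by move=> x y a b f _; exact: mscaleA.
- by move=> x y a f g _ _; apply: mhom_ext => w k; exact: (Defs.scaleDr H _ I I).
- by move=> x y a b f _; apply: mhom_ext => w k; exact: (Defs.scaleDl H _ _ I).
- by move=> x y f; exact: mnorm_ge0.
- by move=> x y f; exact: mnorm_eq0.
- by move=> x y a f; exact: mnormZ.
- by move=> x y f g; exact: mnormD.
- by move=> x y u; exact: mcauchy_cvg.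
- move=> x y z g1 g2 f _ _ fm; apply: mhom_ext => w k //=.
  exact: (mult_addR (H := H) fm).
- move=> x y z g f1 f2 gm _ _; apply: mhom_ext => w k //=.
  exact: (mult_addL (H := H) gm).
- move=> x y z a g f _ fm; apply: mhom_ext => w k //=.
  exact: (mult_scaleR (H := H) fm).
- move=> x y z a g f gm _; apply: mhom_ext => w k //=.
  exact: (mult_scaleL (H := H) gm).
- by [].
- by move=> x y z g f; exact: mnorm_comp.
- by move=> x y f g _ _; apply: mhom_ext => w k; exact: (Defs.starD H I I).
- by move=> x y a f _; apply: mhom_ext => w k; exact: (Defs.starZ H _ I).
- by move=> x y f _; apply: mhom_ext => w k /=; rewrite !(hstarK (H := H)).
- by move=> x y z g f _ _; apply: mhom_ext => w k /=; rewrite !(hstarK (H := H)).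
- by move=> x y f; exact: mnorm_star_comp.
- by move=> x y f; exact: mult_star_pos.
Qed.

Lemma mid_is_identity (c : obj P) : @is_identity R (MC P) (@is_mult R P) c (mid c).
Proof. by split; [exact: is_mult_id | move=> y f _; exact: mhom_ext ..]. Qed.

(** Since [incl] is isometric, approximants of [m] form a Cauchy sequence of morphisms; its limit
    [u] acts on each [h] as [m] does. *)
Lemma closed_incl (c d : obj P) (m : chom (MC P) c d) : is_mult m ->
  (forall e : R, 0 < e -> exists f : chom P c d, all_homs _ _ f /\ hnorm (hsub m (incl f)) < e) ->
  exists f : chom P c d, all_homs _ _ f /\ m = incl f.
Proof.
move=> mm approx.
have /choice[f fP] n : exists f : homsp H c d, hnorm (hsub m (incl f)) < n.+1%:R^-1.
  by have [|f [_ fe]] := approx n.+1%:R^-1; [rewrite invr_gt0 | exists f].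
have mf n : is_mult (hsub m (incl (f n)) : chom (MC P) c d).
  by apply: (is_multD H) => //; apply: (is_multZ H); exact: is_mult_incl.
have small (e : R) : 0 < e -> exists N, forall n, (N <= n)%N -> hnorm (hsub m (incl (f n))) < e.
  (* From this index on, [n + 1] exceeds [1 / e]. *)
  move=> e0; exists (Num.truncn e^-1) => n Nn; apply: (lt_le_trans (fP n)).
  rewrite invf_ple ?posrE //; apply: ltW; apply: lt_le_trans (real_truncnS_gt _) _.
    exact: num_real.
  by rewrite ler_nat ltnS.
have [u fu] : exists u : homsp H c d, forall e : R, 0 < e -> exists N, forall n, (N <= n)%N ->
    hnorm (f n - u) < e.
  apply: hcauchy_cvg => e e0; have e20 : 0 < e / 2 by rewrite divr_gt0.
  have [N hN] := small _ e20; exists N => k n Nk Nn.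
  rewrite -(mnorm_incl (H := H)).
  have -> : incl (f k - f n) = hadd (hsub m (incl (f n))) (hscale (-1) (hsub m (incl (f k)))).
    have subr_sub x y (g g' h : homsp H x y) : g' - g = (h - g) - (h - g').
      by rewrite opprB [RHS]addrC addrA subrK.
    apply: mhom_ext => x h; rewrite /= ?(hcompBl (H := H)) ?(hcompBr (H := H)); exact: subr_sub.
  apply: le_lt_trans (mnormD H (mf n) (is_multZ H _ (mf k))) _.
  rewrite (mnormZ H) // (_ : Normc.normc (-1) = 1) ?mul1r.
    by have := hN _ Nk; have := hN _ Nn; lra.
  by rewrite /= oppr0 expr0n sqrrN expr1n addr0 sqrtr1.
exists u; split=> //; apply: (mult_ext (H := H) mm (is_mult_incl H u)) => x h.
apply: (@hdist_eq0 _ _ H _ _ _ _ (2 * hnorm h)) => e e0.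
have [N hN] := small _ e0; have [N' hN'] := fu _ e0.
have := hN _ (leq_maxl N N'); have := hN' _ (leq_maxr N N').
set n := maxn N N' => h1 h2.
apply: le_trans (hdist_triangle (hcomp (f n) h : homsp H x d) _ _) _.
rewrite mulr_natl mulr2n mulrDl; apply: lerD.
  apply: le_trans (le_mnorm (mf n) h) _; rewrite [leRHS]mulrC.
  by rewrite ler_wpM2r ?(ltW h2) ?(hnorm_ge0 (H := H)).
rewrite -(hcompBl (H := H)); apply: le_trans (hnorm_comp (H := H) _ _) _.
by rewrite [leRHS]mulrC ler_wpM2r ?(ltW h1) ?(hnorm_ge0 (H := H)).
Qed.
End StarPositivity.

(** * Universal property *)

Section Transport.
Variables (R : realType) (P : precat R).
Implicit Types a b c : obj P.

(** Objects on the two sides of the universal property match only up to propositional equality;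
    destructing the equalities makes each compatibility with transport trivial. *)
Lemma htransportD a b a' b' (ea : a = a') (eb : b = b') (f g : chom P a b) :
  htransport ea eb (hadd f g) = hadd (htransport ea eb f) (htransport ea eb g).
Proof. by case: _ / ea; case: _ / eb. Qed.

Lemma htransportZ a b a' b' (ea : a = a') (eb : b = b') k (f : chom P a b) :
  htransport ea eb (hscale k f) = hscale k (htransport ea eb f).
Proof. by case: _ / ea; case: _ / eb. Qed.

Lemma htransport_comp a b c a' b' c' (ea : a = a') (eb : b = b') (ec : c = c')
    (g : chom P b c) (f : chom P a b) :
  htransport ea ec (hcomp g f) = hcomp (htransport eb ec g) (htransport ea eb f).
Proof. by case: _ / ea; case: _ / eb; case: _ / ec. Qed.

Lemma htransport_star a b a' b' (ea : a = a') (eb : b = b') (f : chom P a b) :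
  htransport eb ea (hstar f) = hstar (htransport ea eb f).
Proof. by case: _ / ea; case: _ / eb. Qed.

Lemma htransport_mem (M : homs_pred P) a b a' b' (ea : a = a') (eb : b = b')
    (f : chom P a b) : M _ _ f -> M _ _ (htransport ea eb f).
Proof. by case: _ / ea; case: _ / eb. Qed.

Lemma htransport_identity (M : homs_pred P) a a' (ea : a = a') (e : chom P a a) :
  is_identity M e -> is_identity M (htransport ea ea e).
Proof. by case: _ / ea. Qed.

End Transport.

Lemma incl_is_ideal_inclusion (R : realType) (P : precat R) (H : cstar_cat P) :
  @is_ideal_inclusion R P (MC P) all_homs (@is_mult R P) (fun x : obj P => x) (@incl R P).
Proof.
split; last split; last split; last split; last split.
- split.
  + by move=> x y f _; exact: is_mult_incl.
  + by move=> x y f g _ _; exact: (inclD (H := H)).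
  + by move=> x y a f _; exact: (inclZ (H := H)).
  + by move=> x y z g f _ _; exact: (incl_comp (H := H)).
  + by move=> x y f _; exact: (incl_star (H := H)).
- by exists id.
- by move=> x y f _; exact: (mnorm_incl (H := H)).
- by move=> x y g; exact: closed_incl.
- move=> x y z f h _ hm; exists (h.1 _ f); split=> //.
  exact: (mcomp_incl (H := H)).
- move=> w x y f h _ hm; exists (h.2 _ f); split=> //.
  exact: (incl_mcomp (H := H)).
Qed.

(** * Multipliers induced by an ideal inclusion *)

Section UniversalProperty.
Variables (R : realType) (P Q : precat R) (H : cstar_cat P) (HQ : cstar_cat Q).
Variables (F0 : obj P -> obj Q).
Variable F1 : forall x y, chom P x y -> chom Q (F0 x) (F0 y).
Arguments F1 {x y}.
Hypothesis F1_ideal : is_ideal_inclusion all_homs all_homs (@F1).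

Lemma ideal_comp x y z (g : homsp H y z) (f : homsp H x y) :
  F1 (hcomp g f) = hcomp (F1 g) (F1 f).
Proof. by case: F1_ideal => -[_ _ _ F1C _] _; exact: F1C. Qed.

Lemma ideal_add x y (f g : homsp H x y) :
  F1 (f + g) = (F1 f : homsp HQ _ _) + (F1 g : homsp HQ _ _).
Proof. by case: F1_ideal => -[_ F1D _ _ _] _; exact: F1D. Qed.

Lemma ideal_scale x y k (f : homsp H x y) : F1 (k *: f) = k *: (F1 f : homsp HQ _ _).
Proof. by case: F1_ideal => -[_ _ F1Z _ _] _; exact: F1Z. Qed.

Lemma ideal_star x y (f : homsp H x y) : F1 (hstar f) = hstar (F1 f).
Proof. by case: F1_ideal => -[_ _ _ _ F1S] _; exact: F1S. Qed.

Lemma ideal_norm x y (f : homsp H x y) : hnorm (F1 f) = hnorm f.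
Proof. by case: F1_ideal => _ [_ [F1N _]]; exact: F1N. Qed.

Lemma ideal_inj x y (f g : homsp H x y) : F1 f = F1 g -> f = g.
Proof.
move=> fg; apply/eqP; rewrite -subr_eq0; apply/eqP/(hnorm_eq0 (H := H)).
by rewrite -ideal_norm -scaleN1r ideal_add ideal_scale fg scaleN1r subrr (hnorm0 HQ).
Qed.

(** A sigma type rather than an existential, so that the preimage can be used as data in
    [ideal_mult]. *)
Lemma ideal_lactP x y z (q : chom Q (F0 y) (F0 z)) (f : chom P x y) :
  {g : chom P x z | F1 g = hcomp q (F1 f)}.
Proof.
apply: cid; case: F1_ideal => _ [_ [_ [_ [absorb _]]]].
by have [g [_ gP]] := absorb _ _ _ f q I I; exists g.
Qed.

Lemma ideal_ractP w x y (q : chom Q (F0 w) (F0 x)) (f : chom P x y) :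
  {g : chom P w y | F1 g = hcomp (F1 f) q}.
Proof.
apply: cid; case: F1_ideal => _ [_ [_ [_ [_ absorb]]]].
by have [g [_ gP]] := absorb _ _ _ f q I I; exists g.
Qed.

Definition ideal_mult x y (q : chom Q (F0 x) (F0 y)) : chom (MC P) x y :=
  (fun E h => sval (ideal_lactP q h), fun E h => sval (ideal_ractP q h)).

Lemma ideal_multL x y (q : chom Q (F0 x) (F0 y)) E (h : homsp H E x) :
  F1 ((ideal_mult q).1 E h) = hcomp q (F1 h).
Proof. exact: svalP (ideal_lactP q h). Qed.

Lemma ideal_multR x y (q : chom Q (F0 x) (F0 y)) E (h : homsp H y E) :
  F1 ((ideal_mult q).2 E h) = hcomp (F1 h) q.
Proof. exact: svalP (ideal_ractP q h). Qed.

(** Compatibility is associativity in [Q], pulled back along the injective [F1]; the bound [||q||]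
    comes from isometry. *)
Lemma is_mult_ideal x y (q : chom Q (F0 x) (F0 y)) : is_mult (ideal_mult q).
Proof.
apply: (@is_multP _ _ H _ _ _ (hnorm q)) => [u v g f|u h].
  by apply: ideal_inj; rewrite !ideal_comp ideal_multL ideal_multR (hcompA (H := HQ)).
by rewrite -ideal_norm ideal_multL -[hnorm h]ideal_norm; exact: (hnorm_comp (H := HQ)).
Qed.

Lemma ideal_multD x y (q q' : homsp HQ (F0 x) (F0 y)) :
  ideal_mult (q + q') = hadd (ideal_mult q) (ideal_mult q').
Proof.
apply: mhom_ext => u h; apply: ideal_inj; rewrite ideal_add.
  by rewrite !ideal_multL; exact: hcompDl.
by rewrite !ideal_multR; exact: hcompDr.
Qed.

Lemma ideal_multZ x y k (q : homsp HQ (F0 x) (F0 y)) :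
  ideal_mult (k *: q) = hscale k (ideal_mult q).
Proof.
apply: mhom_ext => u h; apply: ideal_inj; rewrite ideal_scale.
  by rewrite !ideal_multL; exact: hcompZl.
by rewrite !ideal_multR; exact: hcompZr.
Qed.

Lemma ideal_mult_comp x y z (q : homsp HQ (F0 y) (F0 z)) (q' : homsp HQ (F0 x) (F0 y)) :
  ideal_mult (hcomp q q') = hcomp (ideal_mult q) (ideal_mult q').
Proof.
apply: mhom_ext => u h; apply: ideal_inj.
  by rewrite !ideal_multL (hcompA (H := HQ)).
by rewrite !ideal_multR (hcompA (H := HQ)).
Qed.

Lemma ideal_mult_star x y (q : homsp HQ (F0 x) (F0 y)) :
  ideal_mult (hstar q) = hstar (ideal_mult q).
Proof.
apply: mhom_ext => u h; apply: ideal_inj; rewrite /= ideal_star.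
  by rewrite ideal_multL ideal_multR ideal_star (hstar_comp (H := HQ)) !(hstarK (H := HQ)).
by rewrite ideal_multL ideal_multR ideal_star (hstar_comp (H := HQ)) !(hstarK (H := HQ)).
Qed.

Lemma ideal_mult_incl x y (f : homsp H x y) : ideal_mult (F1 f) = incl f.
Proof.
apply: mhom_ext => u h; apply: ideal_inj.
  by rewrite ideal_multL ideal_comp.
by rewrite ideal_multR ideal_comp.
Qed.

Lemma ideal_mult_identity x (e : chom Q (F0 x) (F0 x)) :
  is_identity all_homs e -> @is_identity R (MC P) (@is_mult R P) x (ideal_mult e).
Proof.
move=> [_ eR eL]; suff -> : ideal_mult e = mid x by exact: mid_is_identity.
apply: mhom_ext => u h; apply: ideal_inj.
  by rewrite ideal_multL eL.
by rewrite ideal_multR eR.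
Qed.

(** A multiplier is determined by its products with morphisms from the ideal, as [incl] is
    injective. *)
Lemma ideal_mult_unique x y (q : chom Q (F0 x) (F0 y)) (m : chom (MC P) x y) :
  is_mult m ->
  (forall z (h : homsp H z x), hcomp m (incl h) = incl ((ideal_mult q).1 z h)) ->
  m = ideal_mult q.
Proof.
move=> mm mq; apply: (mult_ext (H := H) mm (is_mult_ideal q)) => z h.
by apply: (incl_inj (H := H)); rewrite -mq (mcomp_incl (H := H)).
Qed.

(** In use, [ex] comes from one inverse law of [F0] and [px] from the other. Nothing relates the two
    proofs, so proof irrelevance reduces [px] and [py] to reflexivity. *)
Lemma ideal_mult_htransport x x' y y' (ex : x' = x) (ey : y' = y)
    (px : F0 x = F0 x') (py : F0 y = F0 y') (q : chom Q (F0 x) (F0 y)) :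
  htransport (ex : (x' : obj (MC P)) = x) ey (ideal_mult (htransport px py q)) = ideal_mult q.
Proof.
case: _ / ex px q; case: _ / ey py => py px q.
by rewrite (Prop_irrelevance px erefl) (Prop_irrelevance py erefl).
Qed.

(** Up to transport, [G(q) incl(h) = G(q) G(F h) = G(q F(h))], and [q F(h)] lies in the ideal, where
    [G] is prescribed. *)
Lemma star_functor_ideal_mult (G0 : obj Q -> obj (MC P))
    (G1 : forall a b, chom Q a b -> chom (MC P) (G0 a) (G0 b))
    (e : forall x, G0 (F0 x) = x) :
  @is_star_functor R Q (MC P) all_homs (@is_mult R P) _ G1 ->
  (forall x y (f : chom P x y), htransport (e x) (e y) (G1 _ _ (F1 f)) = incl f) ->
  forall x y (q : chom Q (F0 x) (F0 y)),
    htransport (e x) (e y) (G1 _ _ q) = ideal_mult q.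
Proof.
move=> [G1M _ _ G1C _] G1F x y q; apply: ideal_mult_unique.
  by apply: (@htransport_mem _ (MC P) (@is_mult R P)); exact: G1M.
move=> z h; rewrite -(G1F _ _ h) -htransport_comp -G1C //.
by rewrite -ideal_multL G1F.
Qed.

Theorem multiplier_universal :
  exists (G0 : obj Q -> obj (MC P))
         (G1 : forall a b, chom Q a b -> chom (MC P) (G0 a) (G0 b)),
    [/\ @is_star_functor R Q (MC P) all_homs (@is_mult R P) _ G1,
        @is_unital_functor R Q (MC P) all_homs (@is_mult R P) _ G1,
        (exists e : forall x, G0 (F0 x) = x,
           forall x y (f : chom P x y),
             htransport (e x) (e y) (G1 _ _ (F1 f)) = incl f) &
        (forall (G0' : obj Q -> obj (MC P))
                (G1' : forall a b, chom Q a b -> chom (MC P) (G0' a) (G0' b)),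
           @is_star_functor R Q (MC P) all_homs (@is_mult R P) _ G1' ->
           (exists e : forall x, G0' (F0 x) = x,
              forall x y (f : chom P x y),
                htransport (e x) (e y) (G1' _ _ (F1 f)) = incl f) ->
           exists e : forall a, G0' a = G0 a,
             forall a b (g : chom Q a b),
               htransport (e a) (e b) (G1' a b g) = G1 a b g)].
Proof.
have [_ [[G0 F0K G0K] _]] := F1_ideal.
(* [ideal_mult] accepts only morphisms between objects of the form [F0 x]; [tr] brings [q] into that
   form with [x = G0 a]. *)
pose tr a b (q : chom Q a b) := htransport (esym (G0K a)) (esym (G0K b)) q.
exists G0, (fun a b q => ideal_mult (tr a b q)); split.
- split.
  + by move=> a b q _; exact: is_mult_ideal.
  + by move=> a b q q' _ _; rewrite /tr htransportD; exact: ideal_multD.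
  + by move=> a b k q _; rewrite /tr htransportZ; exact: ideal_multZ.
  + move=> a b c q q' _ _; rewrite /tr (htransport_comp _ (esym (G0K b))).
    exact: ideal_mult_comp.
  + by move=> a b q _; rewrite /tr htransport_star; exact: ideal_mult_star.
- by move=> a e ide; apply: ideal_mult_identity; exact: htransport_identity.
- exists F0K => x y f; rewrite /tr ideal_mult_htransport; exact: ideal_mult_incl.
move=> G0' G1' G1'_star [e G1'F].
(* The chain [G0' a = G0' (F0 (G0 a)) = G0 a]. *)
exists (fun a => etrans (congr1 G0' (esym (G0K a))) (e (G0 a))) => a b g.
(* The objects and their equalities are generalized so that [ea] and [eb] can be destructed, which
   is impossible for [G0K a] itself. *)
have key x y a' b' (ea : F0 x = a') (eb : F0 y = b') (ex : G0' a' = x) (ey : G0' b' = y)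
    (q : chom Q a' b') :
    htransport ex ey (G1' a' b' q) = ideal_mult (htransport (esym ea) (esym eb) q).
  case: _ / ea ex q => ex; case: _ / eb ey => ey q.
  rewrite (Prop_irrelevance ex (e x)) (Prop_irrelevance ey (e y)).
  exact: star_functor_ideal_mult.
exact: key.
Qed.

End UniversalProperty.

Theorem theorem3p4 (R : realType) (P : precat R) :
  cstar_cat P ->
  [/\ (* (1) MC is a unital C*-category, and ||L|| = ||R|| *)
      is_cstar_on (MC P) (@is_mult R P) /\ unital_on (MC P) (@is_mult R P),
      (forall c d (m : chom (MC P) c d), is_mult m -> fam_normL m.1 = fam_normR m.2),
      (* (2) C -> MC is an ideal inclusion *)
      @is_ideal_inclusion R P (MC P) all_homs (@is_mult R P) (fun x : obj P => x) (@incl R P) &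
      (* (3) universal property *)
      forall (Q : precat R) (F0 : obj P -> obj Q)
             (F1 : forall x y, chom P x y -> chom Q (F0 x) (F0 y)),
        cstar_cat Q -> unital_on Q all_homs ->
        is_ideal_inclusion all_homs all_homs F1 ->
        exists (G0 : obj Q -> obj (MC P))
               (G1 : forall a b, chom Q a b -> chom (MC P) (G0 a) (G0 b)),
          [/\ @is_star_functor R Q (MC P) all_homs (@is_mult R P) _ G1,
              @is_unital_functor R Q (MC P) all_homs (@is_mult R P) _ G1,
              (exists e : forall x, G0 (F0 x) = x,
                 forall x y (f : chom P x y),
                   htransport (e x) (e y) (G1 _ _ (F1 _ _ f)) = incl f) &
              (forall (G0' : obj Q -> obj (MC P))
                      (G1' : forall a b, chom Q a b -> chom (MC P) (G0' a) (G0' b)),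
                 @is_star_functor R Q (MC P) all_homs (@is_mult R P) _ G1' ->
                 @is_unital_functor R Q (MC P) all_homs (@is_mult R P) _ G1' ->
                 (exists e : forall x, G0' (F0 x) = x,
                    forall x y (f : chom P x y),
                      htransport (e x) (e y) (G1' _ _ (F1 _ _ f)) = incl f) ->
                 exists e : forall a, G0' a = G0 a,
                   forall a b (g : chom Q a b),
                     htransport (e a) (e b) (G1' a b g) = G1 a b g)]].
Proof.
move=> H; split.
- split; first exact: MC_cstar.
  by move=> c; exists (@mid R P c); exact: mid_is_identity.
- by move=> c d m; exact: fam_normLR.
- exact: incl_is_ideal_inclusion.
move=> Q F0 F1 HQ _ F1_ideal.
have [G0 [G1 [G1_star G1_unital G1_F G1_unique]]] := multiplier_universal H HQ F1_ideal.
exists G0, G1; split=> // G0' G1' G1'_star _; exact: G1_unique.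
Qed.
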